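(* Assume the setting in the context, suppose $\mathbb P$ has finite range of dependence, and suppose there is a non-random constant $C_*>0$ such that for $\mathcal P$-a.a. $\omega$, $c_{x,y}(\omega)\le C_*$ for all edges $\{x,y\}$ of $\mathrm{DT}(\hat\omega)$. Then Assumption SEP is satisfied.
   Context: $\mathcal N$ = locally finite subsets of $\mathbb R^d$, identified with counting measures ($\xi(A)=\#(\xi\cap A)$), $\sigma$-algebra generated by $\xi\mapsto\xi(A)$; $\tau_x\xi:=\xi-x$. $\mathrm{Vor}(x|\xi)=\{y:|y-x|\le|y-z|\ \forall z\in\xi\}$; $\mathrm{DT}(\xi)$ is the graph on $\xi$ with edges $\{x,y\}$, $x\ne y$, such that $\mathrm{Vor}(x|\xi)$ and $\mathrm{Vor}(y|\xi)$ share a $(d-1)$-dimensional face; write $x\sim y$. Setting: on a probability space $(\Omega,\mathcal F,\mathcal P)$ there is a simple point process $\omega\mapsto\hat\omega\in\mathcal N$ whose law $\mathbb P$ is stationary ($\mathbb P(\tau_xA)=\mathbb P(A)$ for all $x$) with finite intensity $\mathbb E[\xi([0,1]^d)]$; for each pair $x\sim y$ in $\mathrm{DT}(\hat\omega)$ there are non-negative values $c^{o}_{x,y}(\omega)$, $c^o_{y,x}(\omega)$, and $c_{x,y}(\omega):=c^o_{x,y}(\omega)+c^o_{y,x}(\omega)$. $\mathbb P$ has finite range of dependence if there is $L>0$ such that $\xi\cap A$ and $\xi\cap B$ are independent under $\mathbb P$ for all Borel $A,B\subset\mathbb R^d$ at Euclidean distance at least $L$. Assumption SEP: for $\mathcal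 P$-a.a. $\omega$ there exists $t_0=t_0(\omega)>0$ such that, if each edge $\{x,y\}$ of $\mathrm{DT}(\hat\omega)$ is kept independently with probability $1-e^{-t_0c_{x,y}(\omega)}$ (and erased otherwise), then almost surely the resulting undirected graph has only connected components of finite cardinality. *)

(* Defs.v *)
From HB Require Import structures.
From mathcomp Require Import all_boot all_order all_algebra.
From mathcomp Require Import all_classical all_reals all_analysis.
From Stdlib Require Import Relations.Relation_Operators.

Set Implicit Arguments.
Unset Strict Implicit.
Unset Printing Implicit Defensive.

Import Order.TTheory GRing.Theory Num.Theory.
Import numFieldNormedType.Exports.

Local Open Scope classical_set_scope.
Local Open Scope ring_scope.

Section Geometry.
Variables (R : realType) (d : nat).

Local Notation point := 'rV[R]_d.

Definition euclid_dist (x y : point) : R :=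
  Num.sqrt (\sum_(i < d) (x ord0 i - y ord0 i) ^+ 2).

Definition locally_finite (xi : set point) : Prop :=
  forall (c : point) (r : R), finite_set (xi `&` [set y | euclid_dist c y <= r]).

Definition Nconf : set (set point) := [set xi | locally_finite xi].

Definition borelRd (A : set point) : Prop := <<s setT, [set U | open U] >> A.

Definition npts (xi : set point) (A : set point) : \bar R := counting (xi `&` A).

Definition Nmeasurable (E : set (set point)) : Prop :=
  <<s Nconf, [set [set xi | Nconf xi /\ npts xi A = k] | A in borelRd & k in setT] >> E.

Definition tau (x : point) (xi : set point) : set point := (fun y => y - x) @` xi.
Definition tauE (x : point) (E : set (set point)) : set (set point) := tau x @` E.

Definition Vor (x : point) (xi : set point) : set point :=
  [set y | forall z, xi z -> euclid_dist y x <= euclid_dist y z].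

Definition convexS (F : set point) : Prop :=
  forall a b (t : R), F a -> F b -> 0 <= t <= 1 -> F ((1 - t) *: a + t *: b).

Definition face_of (F C : set point) : Prop :=
  [/\ F `<=` C, convexS F &
      forall a b (t : R), C a -> C b -> 0 < t < 1 ->
        F ((1 - t) *: a + t *: b) -> F a /\ F b].

Definition aff_indep (m : nat) (p : 'I_m.+1 -> point) : Prop :=
  \rank (\matrix_(i < m) (p (lift ord0 i) - p ord0)) = m.

Definition has_dim (F : set point) (m : nat) : Prop :=
  (exists p : 'I_m.+1 -> point, (forall i, F (p i)) /\ aff_indep p) /\
  (forall p : 'I_m.+2 -> point, (forall i, F (p i)) -> ~ aff_indep p).

Definition DT (xi : set point) (x y : point) : Prop :=
  [/\ xi x, xi y, x <> y &
      exists F, [/\ face_of F (Vor x xi), face_of F (Vor y xi) & has_dim F d.-1]].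

End Geometry.

Section Prob.
Local Open Scope ereal_scope.
Variables (R : realType) (d : nat).
Local Notation point := 'rV[R]_d.

Definition edges_indep (dT : measure_display) (T : measurableType dT)
    (Q : probability T R) (E : point -> point -> Prop)
    (K : point -> point -> set T) : Prop :=
  forall s : seq (point * point),
    (forall e, e \in s -> E e.1 e.2) ->
    pairwise (fun e f => ~~ ((e == f) || (e == (f.2, f.1)))) s ->
    Q (\big[setI/setT]_(e <- s) K e.1 e.2) = \prod_(e <- s) Q (K e.1 e.2).

Definition dt_cluster (T : Type) (xi : set point) (K : point -> point -> set T)
    (q : T) (x : point) : set point :=
  [set y | @clos_refl_trans point (fun a b => DT xi a b /\ K a b q) x y].

End Prob.

(* Main.v *)
Require Import Defs.
From HB Require Import structures.
From mathcomp Require Import all_boot all_order all_algebra.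
From mathcomp Require Import all_classical all_reals all_analysis.
From mathcomp Require Import zify lra ring.
From Stdlib Require Import Relations.Relation_Operators.

Import Order.TTheory GRing.Theory Num.Theory numFieldNormedType.Exports.
Local Open Scope classical_set_scope.
Local Open Scope ring_scope.

(** Tile space by cubes of side [2s].  Since the Voronoi cell of [x] is convex, every
    point of the segment from [x] to a common point of the cells of [x] and [y] lies
    in the cell of [x], hence in an empty cube or at bounded distance from [x].  So
    the cubes of the endpoints of a Delaunay edge are either close to each other or
    joined by a chain of cubes having an empty cube nearby.  An infinite open cluster
    therefore produces arbitrarily long self-avoiding walks of cubes each of which
    either has an irregular (empty or overcrowded) cube nearby, or has no irregular
    cube nearby and meets a short open edge.

    By stationarity and finite range of dependence the configuration is a.s. empty or
    a.s. nonempty (if [p] is the probability of being empty then [p <= p ^ 2]); in the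
    second case irregular cubes are as rare as we like once [s] and then the
    overcrowding threshold are large.  A fixed proportion of the cubes of a walk are
    pairwise far apart, so a Peierls count bounds the probability of a walk at least
    half of whose cubes are near irregular ones, by finite range of dependence, and,
    for a fixed configuration and small [t0], of a walk at least half of whose cubes
    meet a short open edge, by independence of the edges. *)

(** * Walks on the integer lattice *)

Definition within (d M : nat) : rel 'rV[int]_d :=
  fun u v => [forall i, `|u ord0 i - v ord0 i| <= M%:Z].

Definition apart (d k : nat) : rel 'rV[int]_d :=
  fun u v => [exists i, k%:Z <= `|u ord0 i - v ord0 i|].

Lemma within_refl (d M : nat) (u : 'rV[int]_d) : within d M u u.
Proof. by apply/forallP => i; rewrite subrr normr0. Qed.

Lemma within_sym (d M : nat) (u v : 'rV[int]_d) : within d M u v = within d M v u.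
Proof. by apply: eq_forallb => i; rewrite distrC. Qed.

Lemma within_le (d M N : nat) (u v : 'rV[int]_d) :
  (M <= N)%N -> within d M u v -> within d N u v.
Proof.
move=> MN /forallP uv; apply/forallP => i.
by apply: le_trans (uv i) _; rewrite lez_nat.
Qed.

Lemma within_trans (d M N : nat) (u v w : 'rV[int]_d) :
  within d M u v -> within d N v w -> within d (M + N) u w.
Proof.
move=> /forallP uv /forallP vw; apply/forallP => i.
by have := uv i; have := vw i; lia.
Qed.

Lemma within_path (d M : nat) (u : 'rV[int]_d) p :
  path (within d M) u p -> within d (size p * M) u (last u p).
Proof.
elim: p u => [|v p IH] u /=; first by rewrite within_refl.
by case/andP=> uv /IH; rewrite mulSn; apply: within_trans.
Qed.

(** Offsets are vectors over ['I_(M + M).+1] shifted down by [M], so the cardinality of this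
    sup-norm ball, the branching number of the Peierls count, can be read off. *)
Definition nbrs (d M : nat) (u : 'rV[int]_d) : seq 'rV[int]_d :=
  [seq u + (\row_i ((w ord0 i : nat)%:Z - M%:Z)) | w : 'rV['I_(M + M).+1]_d].

Lemma mem_nbrs (d M : nat) (u v : 'rV[int]_d) : (v \in nbrs d M u) = within d M u v.
Proof.
rewrite /nbrs; apply/idP/forallP => [/mapP[w _ ->] i|uv].
  by rewrite !mxE; move: (u ord0 i) (w ord0 i) => a [j jM] /=; lia.
apply/mapP; exists (\row_i inord (absz (v ord0 i - u ord0 i + M%:Z))).
  by rewrite mem_enum.
apply/rowP => i; rewrite !mxE inordK; move: (uv i); move: (u ord0 i) (v ord0 i); lia.
Qed.

Lemma size_nbrs (d M : nat) (u : 'rV[int]_d) :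
  size (nbrs d M u) = ((M + M).+1 ^ d)%N.
Proof. by rewrite size_image card_mx card_ord mul1n. Qed.

Fixpoint walks (d M n : nat) (u : 'rV[int]_d) : seq (seq 'rV[int]_d) :=
  if n is n'.+1
  then flatten [seq [seq v :: p | p <- walks d M n' v] | v <- nbrs d M u]
  else [:: [::]].

Lemma mem_walks (d M n : nat) (u : 'rV[int]_d) p :
  (p \in walks d M n u) = path (within d M) u p && (size p == n).
Proof.
elim: n u p => [|n IH] u p /=.
  by rewrite inE; case: p => [|v p] //=; rewrite andbF.
apply/flatten_mapP/idP => [[v vu /mapP[q qv ->]]|].
  by move: qv vu; rewrite IH mem_nbrs /= eqSS => /andP[-> ->] ->.
case: p => [|v p] //=; rewrite eqSS => /andP[/andP[uv vp] sp].
exists v; first by rewrite mem_nbrs.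
by apply/mapP; exists p => //; rewrite IH vp.
Qed.

Lemma size_walks (d M n : nat) (u : 'rV[int]_d) :
  size (walks d M n u) = (((M + M).+1 ^ d) ^ n)%N.
Proof.
elim: n u => [|n IH] u //=; rewrite size_flatten /shape -map_comp.
have -> : map (size \o (fun v => [seq v :: p | p <- walks d M n v])) (nbrs d M u)
   = nseq (size (nbrs d M u)) (((M + M).+1 ^ d) ^ n)%N.
  by elim: (nbrs d M u) => //= v l ->; rewrite size_map IH.
by rewrite sumn_nseq size_nbrs mulnC -expnS.
Qed.

Definition residue (d k : nat) (u : 'rV[int]_d) : {ffun 'I_d -> 'I_k.+1} :=
  [ffun i => inord (absz (u ord0 i %% k.+1%:Z)%Z)].

(** A nonzero multiple of [k.+1] has absolute value at least [k.+1], so congruent coordinates that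
    differ at all differ by that much. *)
Lemma apart_residue (d k : nat) (u v : 'rV[int]_d) :
  u != v -> residue d k u = residue d k v -> apart d k.+1 u v.
Proof.
move=> uv /ffunP r; apply: contraT; rewrite negb_exists => /forallP uvk.
case/negP: uv; apply/eqP/rowP => i; have := r i; rewrite !ffunE.
move: (uvk i); move: (u ord0 i) (v ord0 i) => a b ab.
have lt c : (absz (c %% k.+1%:Z)%Z < k.+1)%N.
  by have := @ltz_pmod c k.+1%:Z isT; have := @modz_ge0 c k.+1%:Z isT; lia.
move=> /(congr1 val); rewrite /= !inordK //.
have := @modz_ge0 a k.+1%:Z isT; have := @modz_ge0 b k.+1%:Z isT => b0 a0 e.
have {e b0 a0}/eqP : (a %% k.+1%:Z)%Z = (b %% k.+1%:Z)%Z by lia.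
rewrite eqz_mod_dvd => /dvdzP[q e]; move: ab; rewrite e.
case: q e => [[|q]|q] e; rewrite ?mul0r in e *; first lia; rewrite normrM /=; nia.
Qed.

Lemma sum_count_residue (T : eqType) (I : finType) (f : T -> I) (s : seq T) :
  (\sum_(c : I) count (fun x => f x == c) s = size s)%N.
Proof.
elim: s => [|x s IH] /=; first by rewrite big1.
rewrite big_split /= IH (bigD1 (f x)) //= eqxx big1 ?addn0 // => i.
by rewrite eq_sym => /negbTE ->.
Qed.

(** The [k.+1 ^ d] residue classes act as colours: some colour is carried by at least [m] of the
    counted sites, and distinct sites of one colour are apart. *)
Lemma pigeonhole_apart (d k m : nat) (a : pred 'rV[int]_d) (p : seq 'rV[int]_d) :
  uniq p -> (k.+1 ^ d * m <= count a p)%N ->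
  exists S, [/\ subseq S p, all a S, pairwise (apart d k.+1) S & size S = m].
Proof.
move=> up; case: m => [|m] cm; first by exists [::]; rewrite sub0seq.
pose cl c := [seq u <- seq.filter a p | residue d k u == c].
have [c mc] : exists c, (m < size (cl c))%N.
  apply/existsP; apply: contraT; rewrite negb_exists => /forallP small.
  suff : (count a p <= k.+1 ^ d * m)%N.
    have : (0 < k.+1 ^ d)%N by rewrite expn_gt0.
    by move: cm; rewrite mulnS; lia.
  rewrite -size_filter -(sum_count_residue _ _ (residue d k)).
  have le c : (count (fun u => residue d k u == c) (seq.filter a p) <= m)%N.
    by rewrite -size_filter leqNgt; exact: small.
  rewrite -[X in (_ <= X)%N](_ : (\sum_(c : {ffun 'I_d -> 'I_k.+1}) m = _)%N).
    by apply: leq_sum => c _; exact: le.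
  by rewrite sum_nat_const card_ffun !card_ord.
have sub : subseq (take m.+1 (cl c)) (seq.filter a p).
  exact: subseq_trans (take_subseq _ _) (filter_subseq _ _).
exists (take m.+1 (cl c)); split.
- exact: subseq_trans sub (filter_subseq _ _).
- by apply/allP => u /(mem_subseq sub); rewrite mem_filter => /andP[].
- have : uniq (take m.+1 (cl c)) by rewrite take_uniq ?filter_uniq.
  rewrite uniq_pairwise; apply: (@sub_in_pairwise _ [in cl c]).
    move=> u v; rewrite -!topredE /= /cl !mem_filter.
    move=> /andP[/eqP ru _] /andP[/eqP rv _] uv.
    by apply: apart_residue => //; rewrite ru.
  by apply/allP => u /mem_take.
- by rewrite size_takel.
Qed.

(** * Delaunay edges and cubes *)

(** The half-open cube of index [v] has side [2 * s] and centre [2 * s * v]. Centring the cube of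
    index 0 at the origin makes these cubes grow to the whole space as [s] increases. *)
Definition cube (R : realType) (d : nat) (s : R) (y : 'rV[R]_d) : 'rV[int]_d :=
  \row_i Num.floor ((y ord0 i + s) / (2 * s)).

Lemma cubeP (R : realType) (d : nat) (s : R) (y : 'rV[R]_d) (v : 'rV[int]_d) :
  0 < s ->
  cube R d s y = v <->
  forall i, 2 * s * (v ord0 i)%:~R - s <= y ord0 i < 2 * s * (v ord0 i)%:~R + s.
Proof.
move=> s0; have s20 : 0 < 2 * s by lra.
have E i (m : int) : (Num.floor ((y ord0 i + s) / (2 * s)) == m) =
    (2 * s * m%:~R - s <= y ord0 i < 2 * s * m%:~R + s).
  rewrite floor_eq ler_pdivlMr // ltr_pdivrMr // intrD.
  by congr (_ && _); apply/idP/idP => h; nra.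
split=> [<- i|h]; first by rewrite -E mxE.
by apply/rowP => i; rewrite mxE; apply/eqP; rewrite E.
Qed.

Lemma within_cube (R : realType) (d n : nat) (s : R) (y z : 'rV[R]_d) : 0 < s ->
  (forall i, `|y ord0 i - z ord0 i| < 2 * s * n%:R) ->
  within d n (cube R d s y) (cube R d s z).
Proof.
move=> s0 yz; apply/forallP => i.
have /(cubeP R d s y _ s0)/(_ i) := erefl (cube R d s y).
have /(cubeP R d s z _ s0)/(_ i) := erefl (cube R d s z).
move: (cube R d s y ord0 i) (cube R d s z ord0 i) => a b hb ha.
have := yz i; rewrite ltr_norml => /andP[h1 h2].
have : `|(a%:~R - b%:~R : R)| < n%:R + 1.
  by rewrite ltr_norml; apply/andP; split; rewrite -(ltr_pM2l (_ : 0 < 2 * s)); nra.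
by rewrite -intrB -intr_norm natr1 -[_.+1%:R]/(n.+1%:~R) ltr_int; lia.
Qed.

Lemma within_cube_lt (R : realType) (d n : nat) (s : R) (y z : 'rV[R]_d) : 0 < s ->
  within d n (cube R d s y) (cube R d s z) ->
  forall i, `|y ord0 i - z ord0 i| <= 2 * s * n.+1%:R.
Proof.
move=> s0 /forallP yz i.
have /(cubeP R d s y _ s0)/(_ i) := erefl (cube R d s y).
have /(cubeP R d s z _ s0)/(_ i) := erefl (cube R d s z).
have := yz i; move: (cube R d s y ord0 i) (cube R d s z ord0 i) => a b ab hb ha.
have : `|(a%:~R - b%:~R : R)| <= n%:R.
  by rewrite -intrB -intr_norm -[n%:R]/(n%:~R) ler_int.
by rewrite !ler_norml -natr1 => /andP[h1 h2]; apply/andP; split; nra.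
Qed.

Lemma coord_le_dist (R : realType) (d : nat) (x y : 'rV[R]_d) i :
  `|x ord0 i - y ord0 i| <= euclid_dist x y.
Proof.
rewrite -sqrtr_sqr ler_sqrt ?sumr_ge0 // => [|j _]; last exact: sqr_ge0.
by rewrite (bigD1 i) //= lerDl sumr_ge0 // => j _; exact: sqr_ge0.
Qed.

Lemma dist_le_coord (R : realType) (d : nat) (x y : 'rV[R]_d) (a : R) :
  0 <= a -> (forall i, `|x ord0 i - y ord0 i| <= a) -> euclid_dist x y <= a * d%:R.
Proof.
move=> a0 xy; rewrite -[leRHS]ger0_norm ?mulr_ge0 // -sqrtr_sqr ler_sqrt ?sqr_ge0 //.
apply: (@le_trans _ _ (\sum_(i < d) a ^+ 2)).
  by apply: ler_sum => i _; rewrite -[leLHS]real_normK ?num_real // ler_pXn2r ?nnegrE.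
rewrite sumr_const card_ord -[leLHS]mulr_natr exprMn ler_wpM2l ?sqr_ge0 // -natrX ler_nat.
by case: (d) => // n; rewrite leq_pmulr.
Qed.

Lemma finite_cubes (R : realType) (d n : nat) (s : R) (xi : set 'rV[R]_d) u :
  0 < s -> locally_finite xi ->
  finite_set (xi `&` [set y | within d n u (cube R d s y)]).
Proof.
move=> s0 fxi.
have [/eqP ->|/set0P[y0 [_ uy0]]] :=
    boolP (xi `&` [set y | within d n u (cube R d s y)] == set0).
  exact: finite_set0.
(* The ball is centred at a point [y0] of the set itself: indices within [n] of [u] are within
   [n + n] of each other. *)
apply: sub_finite_set (fxi y0 (2 * s * (n + n).+1%:R * d%:R)) => y [xiy uy]; split=> //.
apply: dist_le_coord; first by rewrite !mulr_ge0 // ltW.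
by apply: within_cube_lt => //; apply: within_trans uy; rewrite within_sym.
Qed.

(** The difference of the squared distances to [z] and to [x] is an affine function of the position.
    It is non-negative at [p] by hypothesis and at [x] trivially, hence on the whole segment. *)
Lemma Vor_segment (R : realType) (d : nat) (xi : set 'rV[R]_d) (x p : 'rV[R]_d) (t : R) :
  Vor x xi p -> 0 <= t <= 1 -> Vor x xi (x + t *: (p - x)).
Proof.
move=> xp /andP[t0 t1] z xiz; have := xp z xiz.
have sq_ge0 (a b : 'rV[R]_d) : 0 <= \sum_(i < d) (a ord0 i - b ord0 i) ^+ 2.
  by rewrite sumr_ge0 // => i _; exact: sqr_ge0.
rewrite !ler_sqrt ?sq_ge0 // -subr_ge0 -sumrB => pz; rewrite -subr_ge0 -sumrB.
have -> : \sum_(i < d) (((x + t *: (p - x)) ord0 i - z ord0 i) ^+ 2 -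
      ((x + t *: (p - x)) ord0 i - x ord0 i) ^+ 2) =
    t * (\sum_(i < d) ((p ord0 i - z ord0 i) ^+ 2 - (p ord0 i - x ord0 i) ^+ 2)) +
    (1 - t) * \sum_(i < d) (x ord0 i - z ord0 i) ^+ 2.
  by rewrite !mulr_sumr -big_split; apply: eq_bigr => i _ /=; rewrite !mxE; ring.
by rewrite addr_ge0 // mulr_ge0 // subr_ge0.
Qed.

(** The point [q] is no farther from [x] than from [z], and [z] shares its cube, so this distance is
    at most [2 * s * d], strictly below [2 * s * d.+1]. *)
Lemma Vor_occupied (R : realType) (d : nat) (s : R) (xi : set 'rV[R]_d)
    (x q z : 'rV[R]_d) : 0 < s ->
  Vor x xi q -> xi z -> cube R d s z = cube R d s q ->
  within d d.+1 (cube R d s x) (cube R d s q).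
Proof.
move=> s0 xq xiz zq; apply: within_cube => // i.
rewrite distrC; apply: le_lt_trans (coord_le_dist _ _ _ _ i) _.
apply: le_lt_trans (xq z xiz) _.
have /(dist_le_coord R d q z) : 0 <= 2 * s by lra.
move=> /(_ _)/le_lt_trans; apply; last by rewrite ltr_pM2l ?ltr_nat //; lra.
move=> j.
have /(cubeP R d s q _ s0)/(_ j) := erefl (cube R d s q).
have /(cubeP R d s z _ s0)/(_ j) := zq.
by rewrite ler_norml => ? ?; apply/andP; split; lra.
Qed.

(** Every genuine step has both ends in [H], while the trivial chain exists at any site. This suits
    two points of the same cluster, including a point and itself. *)
Definition linked (d M : nat) (H : set 'rV[int]_d) :=
  clos_refl_trans 'rV[int]_d (fun u v => [/\ within d M u v, H u & H v]).

Lemma linked_sym (d M : nat) (H : set 'rV[int]_d) u v :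
  linked d M H u v -> linked d M H v u.
Proof.
elim=> {u v} [u v [uv Hu Hv]|u|u v w _ uv _ vw].
- by apply: rt_step; rewrite within_sym.
- exact: rt_refl.
- exact: rt_trans uv.
Qed.

Definition vacant (R : realType) (d : nat) (s : R) (xi : set 'rV[R]_d)
  (v : 'rV[int]_d) : Prop := forall z, xi z -> cube R d s z <> v.

(* On the segment from [x] to [p], an occupied cube is within [d.+1] of the cube of [x],
   so the empty cube following the last occupied one is within [d.+2]. *)
Lemma Vor_linked (R : realType) (d : nat) (s : R) (xi : set 'rV[R]_d)
    (H : set 'rV[int]_d) (x p : 'rV[R]_d) : 0 < s -> xi x -> Vor x xi p ->
  (forall v v', vacant R d s xi v -> within d (d.+1 + d.+1) v v' -> H v') ->
  vacant R d s xi (cube R d s p) ->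
  linked d (d.+1 + d.+1) H (cube R d s x) (cube R d s p).
Proof.
move=> s0 xix xp vacH vp; set M := (d.+1 + d.+1)%N.
(* The segment is cut into [J] pieces of length at most [s], half a cube side, so consecutive sample
   points lie in equal or adjacent cubes. The successor keeps [J] positive. *)
pose J := (Num.bound (euclid_dist p x / s)).+1.
have J0 : 0 < J%:R :> R by rewrite ltr0n.
have Jd : euclid_dist p x <= s * J%:R.
  rewrite mulrC -ler_pdivrMr //; apply/ltW/(lt_le_trans (archi_boundP _)).
    by rewrite divr_ge0 ?sqrtr_ge0 // ltW.
  by rewrite ler_nat.
pose q (j : nat) := x + (j%:R / J%:R) *: (p - x).
have qV j : (j <= J)%N -> Vor x xi (q j).
  move=> jJ; apply: Vor_segment => //; apply/andP; split; first by rewrite divr_ge0.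
  by rewrite ler_pdivrMr // mul1r ler_nat.
have step j : within d 1 (cube R d s (q j)) (cube R d s (q j.+1)).
  apply: within_cube => // i; rewrite !mxE mulr1.
  rewrite [X in `|X|](_ : _ = - ((p ord0 i - x ord0 i) / J%:R)); last first.
    by rewrite -natr1; field; rewrite lt0r_neq0.
  rewrite normrN normrM normfV (gtr0_norm J0) ltr_pdivrMr //.
  apply: le_lt_trans (coord_le_dist _ _ _ _ i) _; apply: le_lt_trans Jd _.
  by rewrite ltr_pM2r; lra.
(* Induction along the samples. Sample 0 is [x], whose cube is not vacant. If the previous sample is
   in a vacant cube the chain is prolonged; otherwise the current cube is reached from that of [x]
   in one step, both being near a vacant cube. *)
have key j : (j <= J)%N -> vacant R d s xi (cube R d s (q j)) ->
    linked d M H (cube R d s x) (cube R d s (q j)).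
  elim: j => [|j IH] jJ vj.
    by exfalso; apply: (vj x xix); rewrite /q mul0r scale0r addr0.
  have [vj'|] := pselect (vacant R d s xi (cube R d s (q j))).
    apply: rt_trans (IH (ltnW jJ) vj') _; apply: rt_step; split.
    - exact: within_le (step j).
    - by apply: vacH vj' _; apply: within_refl.
    - by apply: vacH vj _; apply: within_refl.
  move=> /existsNP[z /not_implyP[xiz /contrapT zq]].
  have xq := Vor_occupied R d s xi x (q j) z s0 (qV j (ltnW jJ)) xiz zq.
  have xq1 : within d M (cube R d s x) (cube R d s (q j.+1)).
    by apply: within_le (within_trans _ _ _ _ _ _ xq (step j)); rewrite /M; lia.
  apply: rt_step; split=> //; last by apply: vacH vj _; apply: within_refl.
  by apply: vacH vj _; rewrite within_sym.
have qJ : q J = p by rewrite /q divff ?lt0r_neq0 // scale1r addrC subrK.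
by rewrite -qJ; apply: key => //; rewrite qJ.
Qed.

(** The shared face yields a point [r] of both cells. If its cube is vacant, the chains from [x] and
    [y] to [r] are joined; if it is occupied, both endpoints are within [d.+1] of it and the edge is
    a single short step. *)
Lemma DT_linked (R : realType) (d : nat) (s : R) (xi : set 'rV[R]_d)
    (H : set 'rV[int]_d) (x y : 'rV[R]_d) : 0 < s -> DT xi x y ->
  (forall v v', vacant R d s xi v -> within d (d.+1 + d.+1) v v' -> H v') ->
  (within d (d.+1 + d.+1) (cube R d s x) (cube R d s y) ->
     H (cube R d s x) /\ H (cube R d s y)) ->
  linked d (d.+1 + d.+1) H (cube R d s x) (cube R d s y).
Proof.
move=> s0 [xix xiy _ [F [[Fx _ _] [Fy _ _] [[p [Fp _]] _]]]] vacH nearH.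
have {Fp}Fp := Fp ord0; set r := p ord0 in Fp.
have [vr|] := pselect (vacant R d s xi (cube R d s r)).
  apply: (@rt_trans _ _ _ (cube R d s r)); last apply: linked_sym.
    exact: Vor_linked s0 xix (Fx _ Fp) vacH vr.
  exact: Vor_linked s0 xiy (Fy _ Fp) vacH vr.
move=> /existsNP[z /not_implyP[xiz /contrapT zr]].
have xr := Vor_occupied R d s xi x r z s0 (Fx _ Fp) xiz zr.
have yr := Vor_occupied R d s xi y r z s0 (Fy _ Fp) xiz zr.
have xy : within d (d.+1 + d.+1) (cube R d s x) (cube R d s y).
  by apply: within_trans xr _; rewrite within_sym.
by have [] := nearH xy; move=> Hx Hy; apply: rt_step.
Qed.

Lemma linked_path (d M : nat) (H : set 'rV[int]_d) u v : linked d M H u v ->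
  exists p, [/\ path (within d M) u p, last u p = v & forall w, w \in p -> H w].
Proof.
elim=> {u v} [u v [uv Hu Hv]|u|u v w _ [p [up <- Hp]] _ [p' [vp <- Hp']]].
- exists [:: v]; split=> //=; first by rewrite uv.
  by move=> w; rewrite inE => /eqP ->.
- by exists [::].
- exists (p ++ p'); split; first by rewrite cat_path up.
    by rewrite last_cat.
  by move=> w'; rewrite mem_cat => /orP[/Hp|/Hp'].
Qed.

(** By contraposition: erasing loops from a chain gives a self-avoiding walk. If none has [n] steps,
    all cubes of the cluster are within [n * M] of the first one, and local finiteness leaves
    finitely many points. *)
Lemma infinite_cluster_walk (R : realType) (d M n : nat) (s : R) (xi : set 'rV[R]_d)
    (H : set 'rV[int]_d) (G : 'rV[R]_d -> 'rV[R]_d -> Prop) (x : 'rV[R]_d) :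
  0 < s -> locally_finite xi -> xi x ->
  (forall a b, G a b -> xi b /\ linked d M H (cube R d s a) (cube R d s b)) ->
  ~ finite_set [set y | clos_refl_trans _ G x y] ->
  exists p, [/\ p \in walks d M n (cube R d s x), uniq p & forall v, v \in p -> H v].
Proof.
move=> s0 fxi xix GH; apply: contra_notP => noW.
apply: sub_finite_set (finite_cubes R d (n * M) s xi (cube R d s x) s0 fxi) => y /= xy.
have [xiy lxy] : xi y /\ linked d M H (cube R d s x) (cube R d s y).
  have: xi x by [].
  elim: xy => {x y xix noW} [x y /GH[xiy xy] xix|x xix|x y z _ IH1 _ IH2 xix].
  - by [].
  - by split=> //; exact: rt_refl.
  - have [xiy xy] := IH1 xix; have [xiz yz] := IH2 xiy; split=> //.
    exact: rt_trans xy yz.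
split=> //; have [p [up pv Hp]] := linked_path _ _ _ _ _ lxy.
rewrite -pv; case/shortenP: up => p' up' /= /andP[_ uniqp'] pp'.
have [np|pn] := leqP n (size p').
  exfalso; apply: noW; exists (take n p'); split.
  - by rewrite mem_walks take_path // size_takel // eqxx.
  - by rewrite take_uniq.
  - by move=> v /mem_take/pp'; exact: Hp.
by apply: within_le (within_path _ _ _ _ up'); rewrite leq_mul2r ltnW ?orbT.
Qed.

(** * Events of the configuration space *)

Lemma measure_bigsetU_le (R : realType) (dT : measure_display) (T : measurableType dT)
    (mu : probability T R) (I : eqType) (l : seq I) (E : I -> set T) (c : R) :
  (forall x, x \in l -> measurable (E x)) ->
  (forall x, x \in l -> (mu (E x) <= c%:E)%E) ->
  (mu (\big[setU/set0]_(x <- l) E x) <= ((size l)%:R * c)%:E)%E.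
Proof.
elim: l => [|x l IH] mE cE; first by rewrite big_nil measure0 mul0r.
have mEl : measurable (\big[setU/set0]_(y <- l) E y).
  rewrite big_seq; apply: big_ind => // [A B|y yl]; first exact: measurableU.
  by apply: mE; rewrite inE yl orbT.
have mEx : measurable (E x) by apply: mE; rewrite inE eqxx.
rewrite big_cons; apply: le_trans (measureU2 _ mEx mEl) _.
rewrite /= -nat1r mulrDl mul1r EFinD; apply: leeD.
  by apply: cE; rewrite inE eqxx.
by apply: IH => y yl; [apply: mE|apply: cE]; rewrite inE yl orbT.
Qed.

Lemma in_bigsetU (T : Type) (I : eqType) (l : seq I) (E : I -> set T) x :
  (\big[setU/set0]_(i <- l) E i) x <-> exists2 i, i \in l & E i x.
Proof.
elim: l => [|j l IH]; first by rewrite big_nil; split=> // -[].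
rewrite big_cons; split=> [[Ej|/IH[i il Ei]]|[i]].
- by exists j => //; rewrite inE eqxx.
- by exists i => //; rewrite inE il orbT.
- by rewrite inE => /orP[/eqP -> ?|il Ei]; [left|right; apply/IH; exists i].
Qed.

Lemma in_bigsetI (T : Type) (D : set T) (I : eqType) (l : seq I) (E : I -> set T) x :
  (\big[setI/D]_(i <- l) E i) x <-> D x /\ forall i, i \in l -> E i x.
Proof.
elim: l => [|j l IH]; first by rewrite big_nil; split=> [|[]].
rewrite big_cons; split=> [[Ej /IH[Dx El]]|[Dx El]].
- by split=> // i; rewrite inE => /orP[/eqP ->|/El].
- split; first by apply: El; rewrite inE eqxx.
  by apply/IH; split=> // i il; apply: El; rewrite inE il orbT.
Qed.

(** The intersection of covers of measure at most [n.+1%:R^-1] is a measurable null superset. This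
    spares any measurability proof for [A], such as an event about infinite clusters. *)
Lemma negligible_small (R : realType) (dT : measure_display) (T : measurableType dT)
    (mu : probability T R) (A : set T) :
  (forall e : R, 0 < e -> exists B, [/\ measurable B, A `<=` B & (mu B <= e%:E)%E]) ->
  mu.-negligible A.
Proof.
move=> small.
have /choice[B HB] : forall n : nat, exists B,
    [/\ measurable B, A `<=` B & (mu B <= (n.+1%:R^-1)%:E)%E].
  by move=> n; apply: small; rewrite invr_gt0 ltr0n.
have mB : measurable (\bigcap_n B n).
  by apply: bigcapT_measurable => n; have [] := HB n.
exists (\bigcap_n B n); split=> //; last first.
  by move=> x Ax n _; have [_ AB _] := HB n; exact: AB.
apply/eqP; rewrite eq_le measure_ge0 andbT; apply/lee_addgt0Pr => e e0.
rewrite add0e; have [mBn _] := HB (Num.bound e^-1).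
move=> Ble; have sub : \bigcap_n B n `<=` B (Num.bound e^-1) by move=> x; apply.
apply: le_trans (le_measure _ _ _ sub) _; rewrite ?inE //.
apply: le_trans Ble _; rewrite lee_fin invf_ple ?posrE ?ltr0n //.
apply/ltW/(lt_le_trans (archi_boundP _)); first by rewrite invr_ge0 ltW.
by rewrite ler_nat.
Qed.

Lemma negligible_bigcup_count (R : realType) (dT : measure_display)
    (T : measurableType dT) (mu : probability T R) (I : countType) (F : I -> set T) :
  (forall i, mu.-negligible (F i)) -> mu.-negligible (\bigcup_i F i).
Proof.
move=> nF; apply: (@negligibleS _ _ _ _
    (\bigcup_n (if unpickle n is Some i then F i else set0))).
  by move=> x [i _ Fi]; exists (pickle i) => //; rewrite pickleK.
apply: negligible_bigcup => n; case: unpickle => [i|]; first exact: nF.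
exact: negligible_set0.
Qed.

(** [Nmeasurable] means membership in every sigma-algebra on [Nconf] containing the generators, so
    each closure rule is checked inside an arbitrary one. Complements are relative to [Nconf]. *)
Lemma Nmeasurable_setD (R : realType) (d : nat) (E : set (set 'rV[R]_d)) :
  Nmeasurable E -> Nmeasurable (@Nconf R d `\` E).
Proof. by move=> mE A [[A0 AD AU] sub]; apply: (AD); apply: mE; split. Qed.

Lemma Nmeasurable0 (R : realType) (d : nat) : @Nmeasurable R d set0.
Proof. by move=> A [[A0 AD AU] sub]. Qed.

Lemma Nmeasurable_bigcup (R : realType) (d : nat) (E : nat -> set (set 'rV[R]_d)) :
  (forall n, Nmeasurable (E n)) -> Nmeasurable (\bigcup_n E n).
Proof. by move=> mE A [[A0 AD AU] sub]; apply: (AU) => n; apply: mE; split. Qed.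

Lemma Nmeasurable_setU (R : realType) (d : nat) (E F : set (set 'rV[R]_d)) :
  Nmeasurable E -> Nmeasurable F -> Nmeasurable (E `|` F).
Proof.
move=> mE mF; rewrite -bigcup2E; apply: Nmeasurable_bigcup => -[|[|n]] //.
exact: Nmeasurable0.
Qed.

Lemma Nmeasurable_setI (R : realType) (d : nat) (E F : set (set 'rV[R]_d)) :
  E `<=` @Nconf R d -> Nmeasurable E -> Nmeasurable F -> Nmeasurable (E `&` F).
Proof.
move=> EN mE mF.
rewrite (_ : E `&` F = @Nconf R d `\` ((@Nconf R d `\` E) `|` (@Nconf R d `\` F))).
  apply: Nmeasurable_setD; apply: Nmeasurable_setU; exact: Nmeasurable_setD.
apply/seteqP; split=> [xi [Exi Fxi]|xi [Nxi /not_orP[nE nF]]].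
  by split; [exact: EN|case=> -[]].
by split; apply: contrapT => h; [apply: nE|apply: nF].
Qed.

Lemma Nmeasurable_bigsetU (R : realType) (d : nat) (I : Type) (l : seq I)
    (E : I -> set (set 'rV[R]_d)) :
  (forall i, Nmeasurable (E i)) -> Nmeasurable (\big[setU/set0]_(i <- l) E i).
Proof.
move=> mE; apply: big_ind => //; first exact: Nmeasurable0.
exact: Nmeasurable_setU.
Qed.

Lemma Nmeasurable_conf (R : realType) (d : nat) : Nmeasurable (@Nconf R d).
Proof. by rewrite -[@Nconf R d]setD0; apply: Nmeasurable_setD; apply: Nmeasurable0. Qed.

Lemma Nmeasurable_bigsetI (R : realType) (d : nat) (I : Type) (l : seq I)
    (E : I -> set (set 'rV[R]_d)) :
  (forall i, E i `<=` @Nconf R d) -> (forall i, Nmeasurable (E i)) ->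
  Nmeasurable (\big[setI/@Nconf R d]_(i <- l) E i).
Proof.
move=> EN mE; elim: l => [|i l IH]; first by rewrite big_nil; exact: Nmeasurable_conf.
by rewrite big_cons; apply: Nmeasurable_setI.
Qed.

Definition count_event (R : realType) (d : nat) (A : set 'rV[R]_d)
  (W : set (\bar R)) : set (set 'rV[R]_d) := [set xi | @Nconf R d xi /\ W (npts xi A)].

Lemma Nmeasurable_count_event1 (R : realType) (d : nat) (A : set 'rV[R]_d) k :
  borelRd A -> Nmeasurable (count_event R d A [set k]).
Proof. by move=> bA F [_ sub]; apply: sub; exists A => //; exists k. Qed.

Lemma Nmeasurable_count_eventC (R : realType) (d : nat) (A : set 'rV[R]_d) W :
  Nmeasurable (count_event R d A W) -> Nmeasurable (count_event R d A (~` W)).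
Proof.
move=> /Nmeasurable_setD; congr (Nmeasurable _); apply/seteqP.
by split=> xi [Nxi h]; split=> //; [move=> Wxi; apply: h|case].
Qed.

Lemma Nmeasurable_count_event_seq (R : realType) (d : nat) (A : set 'rV[R]_d)
    (l : seq (\bar R)) :
  borelRd A -> Nmeasurable (count_event R d A [set k | k \in l]).
Proof.
move=> bA; rewrite (_ : count_event _ _ _ _ =
    \big[setU/set0]_(k <- l) count_event R d A [set k]).
  by apply: Nmeasurable_bigsetU => k; exact: Nmeasurable_count_event1.
apply/seteqP; split=> xi.
  by move=> [Nxi xil]; apply/in_bigsetU; exists (npts xi A).
by case/in_bigsetU => k kl [Nxi /= e]; split=> //=; rewrite e.
Qed.

Lemma borel_coord (R : realType) (d : nat) (i : 'I_d) (a b : R) :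
  borelRd [set y : 'rV[R]_d | a <= y ord0 i < b].
Proof.
have lt c : borelRd [set y : 'rV[R]_d | y ord0 i < c].
  apply: sub_sigma_algebra => /=.
  have := @open_comp 'rV[R]_d R (fun y => y ord0 i) [set z | z < c].
  by apply; [move=> y _; exact: coord_continuous|exact: open_lt].
pose G := @measurable _ (g_sigma_algebraType [set U : set 'rV[R]_d | open U]).
have GD A B : G A -> G B -> G (A `\` B) by exact: measurableD.
have -> : [set y : 'rV[R]_d | a <= y ord0 i < b] =
    [set y : 'rV[R]_d | y ord0 i < b] `\` [set y : 'rV[R]_d | y ord0 i < a].
  apply/seteqP; split=> y /=; first by case/andP => ? ->; split=> //; apply/negP; rewrite -leNgt.
  by case=> -> /negP; rewrite -leNgt => ->.
by apply: GD; exact: lt.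
Qed.

Lemma borel_cube (R : realType) (d : nat) (s : R) v : 0 < s ->
  borelRd [set y | cube R d s y = v].
Proof.
move=> s0.
have -> : [set y | cube R d s y = v] = \bigcap_(i in [set: 'I_d])
    [set y : 'rV[R]_d | 2 * s * (v ord0 i)%:~R - s <= y ord0 i < 2 * s * (v ord0 i)%:~R + s].
  apply/seteqP; split=> y /=.
    by move=> /(cubeP _ _ _ _ _ s0) h i _; exact: h.
  by move=> h; apply/(cubeP _ _ _ _ _ s0) => i; exact: (h i I).
have bI := @fin_bigcap_measurable _
  (g_sigma_algebraType [set U : set 'rV[R]_d | open U]) 'I_d setT.
by apply: bI => // i _; exact: borel_coord.
Qed.

Lemma borel_bigsetU (R : realType) (d : nat) (I : Type) (l : seq I)
    (E : I -> set 'rV[R]_d) :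
  (forall i, borelRd (E i)) -> borelRd (\big[setU/set0]_(i <- l) E i).
Proof.
move=> bE; apply: big_ind => //; first exact: (@measurable0 _
  (g_sigma_algebraType [set U : set 'rV[R]_d | open U])).
exact: (@measurableU _ (g_sigma_algebraType [set U : set 'rV[R]_d | open U])).
Qed.

Definition block (R : realType) (d M : nat) (s : R) (u : 'rV[int]_d) : set 'rV[R]_d :=
  [set y | within d M u (cube R d s y)].

Lemma borel_block (R : realType) (d M : nat) (s : R) u : 0 < s ->
  borelRd (block R d M s u).
Proof.
move=> s0; rewrite (_ : block _ _ _ _ _ =
    \big[setU/set0]_(v <- nbrs d M u) [set y | cube R d s y = v]).
  by apply: borel_bigsetU => v; exact: borel_cube.
apply/seteqP; split=> y.
  by move=> uy; apply/in_bigsetU; exists (cube R d s y); rewrite ?mem_nbrs.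
by case/in_bigsetU => v; rewrite mem_nbrs => uv /= e; rewrite /block /= e.
Qed.

Lemma locally_finite_sub (R : realType) (d : nat) (xi eta : set 'rV[R]_d) :
  xi `<=` eta -> locally_finite eta -> locally_finite xi.
Proof.
by move=> sub feta c r; apply: sub_finite_set (feta c r) => y [/sub ? ?].
Qed.

Lemma npts_setI (R : realType) (d : nat) (xi A B : set 'rV[R]_d) :
  B `<=` A -> npts (xi `&` A) B = npts xi B.
Proof. by move=> BA; rewrite /npts -setIA (setIidr BA). Qed.

Lemma counting_image (T U : choiceType) (R : realType) (f : T -> U) (A : set T) :
  injective f -> counting (f @` A) = counting A :> \bar R.
Proof.
move=> fI; rewrite /counting.
have cA : (f @` A #= A)%card by apply: inj_card_eq => x y _ _; exact: fI.
rewrite (eq_finite_set cA); case: asboolP => // fA.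
by congr (_%:R%:E); apply/fcard_eq; rewrite ?(eq_finite_set cA).
Qed.

Lemma counting_natP (T : choiceType) (R : realType) (X : set T) (j : nat) :
  counting X = j%:R%:E :> \bar R -> exists l : seq T,
  size l = j /\ forall x, x \in l <-> X x.
Proof.
rewrite /counting; case: asboolP => // fX [/eqP]; rewrite eqr_nat => /eqP <-.
exists (finmap.enum_fset (fset_set X)); split=> // x.
have -> : (x \in finmap.enum_fset (fset_set X)) = (x \in X) by exact: in_fset_set.
by split=> [/set_mem|/mem_set].
Qed.

Lemma counting_eq0 (T : choiceType) (R : realType) (X : set T) :
  counting X = 0%E :> \bar R <-> X = set0.
Proof.
split=> [/(@counting_natP _ _ _ 0%N)[l [/size0nil -> lX]]|->].
  by apply/eqP/negPn/negP => /set0P[x /lX].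
by rewrite /counting asboolT // fset_set0.
Qed.

Lemma prob_decreasing (R : realType) (dT : measure_display) (T : measurableType dT)
    (P : probability T R) (F : nat -> set T) (e : R) :
  (forall n, measurable (F n)) -> (forall m n, (m <= n)%N -> F n `<=` F m) -> 0 < e ->
  exists N, forall n, (N <= n)%N -> fine (P (F n)) < fine (P (\bigcap_n F n)) + e.
Proof.
move=> mF dF e0.
have mI : measurable (\bigcap_n F n) by apply: bigcapT_measurable.
have := @nonincreasing_cvg_mu _ _ _ P F _ mF mI _.
rewrite -[X in _ --> X](fineK (fin_num_measure P _ mI)) => cF.
have {}cF : (P \o F) n @[n --> \oo] --> (fine (P (\bigcap_n F n)))%:E.
  apply: cF; first by rewrite ltey_eq fin_num_measure.
  by move=> m n mn; rewrite subsetEset; exact: dF.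
have [N _ HN] := (cvgrPdist_lt _ _).1 (fine_cvg cF) e e0.
exists N => n Nn; have := HN n Nn; rewrite ltr_norml /= => /andP[]; lra.
Qed.

(** * Stationarity and finite range of dependence *)

Definition stationary (R : realType) (d : nat) (dO : measure_display)
    (Omega : measurableType dO) (P : probability Omega R)
    (hat : Omega -> set 'rV[R]_d) : Prop :=
  forall (x : 'rV[R]_d) E, Nmeasurable E ->
    P (hat @^-1` tauE x E) = P (hat @^-1` E).

Definition finite_range (R : realType) (d : nat) (dO : measure_display)
    (Omega : measurableType dO) (P : probability Omega R)
    (hat : Omega -> set 'rV[R]_d) (L : R) : Prop :=
  forall A B : set 'rV[R]_d, borelRd A -> borelRd B ->
    (forall a b, A a -> B b -> L <= euclid_dist a b) ->
    forall E1 E2, Nmeasurable E1 -> Nmeasurable E2 ->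
      P (hat @^-1` [set xi | E1 (xi `&` A)] `&`
         hat @^-1` [set xi | E2 (xi `&` B)]) =
      (P (hat @^-1` [set xi | E1 (xi `&` A)]) *
       P (hat @^-1` [set xi | E2 (xi `&` B)]))%E.

Lemma tauK (R : realType) (d : nat) (x : 'rV[R]_d) (xi : set 'rV[R]_d) :
  tau x (tau (- x) xi) = xi.
Proof.
rewrite /tau image_comp (_ : _ \o _ = id) ?image_id //.
by apply/funext => y /=; rewrite opprK addrK.
Qed.

Lemma locally_finite_tau (R : realType) (d : nat) (x : 'rV[R]_d) (xi : set 'rV[R]_d) :
  locally_finite xi -> locally_finite (tau x xi).
Proof.
move=> fxi c r; apply: sub_finite_set (finite_image (fun y => y - x) (fxi (c + x) r)).
move=> _ [[y xiy <-] /= yr]; exists y => //; split=> //=; apply: le_trans yr.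
rewrite /euclid_dist (eq_bigr (fun i => (c ord0 i - (y - x) ord0 i) ^+ 2)) // => i _.
by rewrite !mxE; congr (_ ^+ 2); ring.
Qed.

Lemma npts_tau (R : realType) (d : nat) (x : 'rV[R]_d) (xi A : set 'rV[R]_d) :
  npts (tau x xi) (tau x A) = npts xi A.
Proof.
rewrite /npts -(@counting_image _ _ R (fun y => y - x) (xi `&` A)); last exact: addIr.
congr counting; apply/seteqP; split=> y.
  by case=> -[z xiz <-] [z' Az' /addIr zz']; exists z => //; split=> //; rewrite -zz'.
by case=> z [xiz Az] <-; split; exists z.
Qed.

Lemma tauE_count_event (R : realType) (d : nat) (x : 'rV[R]_d) (A : set 'rV[R]_d) W :
  tauE x (count_event R d A W) = count_event R d (tau x A) W.
Proof.
apply/seteqP; split=> xi.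
  case=> eta [Neta Weta] <-; split; first exact: locally_finite_tau.
  by rewrite npts_tau.
case=> Nxi Wxi; exists (tau (- x) xi); last exact: tauK.
by split; [exact: locally_finite_tau|rewrite -(npts_tau _ _ x) tauK].
Qed.

Lemma tau_cube (R : realType) (d : nat) (s : R) (v : 'rV[int]_d) : 0 < s ->
  tau (- \row_i (2 * s * (v ord0 i)%:~R)) [set y | cube R d s y = 0] =
  [set y | cube R d s y = v].
Proof.
move=> s0; apply/seteqP; split=> [_ [y /(cubeP _ _ _ _ _ s0) y0 <-]|y /(cubeP _ _ _ _ _ s0) yv].
  by apply/(cubeP _ _ _ _ _ s0) => i; have := y0 i; rewrite !mxE; lra.
exists (y - \row_i (2 * s * (v ord0 i)%:~R)); last by rewrite opprK subrK.
by apply/(cubeP _ _ _ _ _ s0) => i; have := yv i; rewrite !mxE; lra.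
Qed.

Lemma prob_cube_count (R : realType) (d : nat) (dO : measure_display)
    (Omega : measurableType dO) (P : probability Omega R)
    (hat : Omega -> set 'rV[R]_d) (s : R) (v : 'rV[int]_d) W :
  0 < s -> stationary R d dO Omega P hat ->
  Nmeasurable (count_event R d [set y | cube R d s y = 0] W) ->
  P (hat @^-1` count_event R d [set y | cube R d s y = v] W) =
  P (hat @^-1` count_event R d [set y | cube R d s y = 0] W).
Proof. by move=> s0 st mW; rewrite -(tau_cube R d s v s0) -tauE_count_event st. Qed.

(** Quantifying over all windows [B] that contain [A] lets locality pass at once to larger sets, in
    particular to unions of blocks. *)
Definition local_event (R : realType) (d : nat) (A : set 'rV[R]_d)
    (E : set (set 'rV[R]_d)) : Prop :=
  forall xi B, Nconf xi -> A `<=` B -> E (xi `&` B) <-> E xi.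

Lemma local_count_event (R : realType) (d : nat) (A B : set 'rV[R]_d) W :
  A `<=` B -> local_event R d B (count_event R d A W).
Proof.
move=> AB xi D Nxi BD; rewrite /count_event /= npts_setI; last exact: subset_trans BD.
by split=> -[_ Wxi]; split=> //; exact: locally_finite_sub Nxi.
Qed.

Lemma finite_range_local (R : realType) (d : nat) (dO : measure_display)
    (Omega : measurableType dO) (P : probability Omega R)
    (hat : Omega -> set 'rV[R]_d) (L : R) (A B : set 'rV[R]_d) E F :
  (forall w, locally_finite (hat w)) -> finite_range R d dO Omega P hat L ->
  borelRd A -> borelRd B -> (forall a b, A a -> B b -> L <= euclid_dist a b) ->
  Nmeasurable E -> Nmeasurable F -> local_event R d A E -> local_event R d B F ->
  (P (hat @^-1` E `&` hat @^-1` F) = P (hat @^-1` E) * P (hat @^-1` F))%E.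
Proof.
move=> fhat fr bA bB AB mE mF lE lF; have := fr A B bA bB AB E F mE mF.
have -> : hat @^-1` [set xi | E (xi `&` A)] = hat @^-1` E.
  by apply/seteqP; split=> w; apply (lE (hat w) A (fhat w) (@subset_refl _ _)).
have -> // : hat @^-1` [set xi | F (xi `&` B)] = hat @^-1` F.
by apply/seteqP; split=> w; apply (lF (hat w) B (fhat w) (@subset_refl _ _)).
Qed.

(** In a coordinate where the centres differ by at least [2M + 2], the cube indices of [a] and [b]
    still differ by at least 2, so a full cube width separates them. *)
Lemma dist_block (R : realType) (d M : nat) (s : R) (u v : 'rV[int]_d) a b : 0 < s ->
  apart d (M + M).+2 u v -> block R d M s u a -> block R d M s v b ->
  2 * s <= euclid_dist a b.
Proof.
move=> s0 /existsP[i uv] /forallP/(_ i) ua /forallP/(_ i) vb.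
apply: le_trans (coord_le_dist _ _ a b i).
have /(cubeP R d s a _ s0)/(_ i) := erefl (cube R d s a).
have /(cubeP R d s b _ s0)/(_ i) := erefl (cube R d s b).
move: uv ua vb; move: (cube R d s a ord0 i) (cube R d s b ord0 i) (u ord0 i) (v ord0 i).
move=> p q u' v' uv ua vb hb ha.
have pq : (2 <= p - q) || (p - q <= -2) by lia.
case/orP: pq => pq.
  have : 2 <= (p%:~R - q%:~R : R) by rewrite -intrB (ler_int R 2).
  by rewrite ler_normr => h; apply/orP; left; nra.
have : (p%:~R - q%:~R : R) <= -2 by rewrite -intrB (ler_int R _ (-2)).
by rewrite ler_normr => h; apply/orP; right; nra.
Qed.

(** Induction on [S]: the block of the head is at distance at least [2 * s], hence at least [L],
    from the union of the other blocks, so finite range splits off one factor. *)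
Lemma prob_apart (R : realType) (d M : nat) (dO : measure_display)
    (Omega : measurableType dO) (P : probability Omega R)
    (hat : Omega -> set 'rV[R]_d) (L s h : R)
    (E : 'rV[int]_d -> set (set 'rV[R]_d)) (S : seq 'rV[int]_d) :
  (forall w, locally_finite (hat w)) ->
  (forall E, Nmeasurable E -> measurable (hat @^-1` E)) ->
  finite_range R d dO Omega P hat L ->
  0 < s -> L <= 2 * s ->
  (forall u, Nmeasurable (E u)) -> (forall u, E u `<=` @Nconf R d) ->
  (forall u, local_event R d (block R d M s u) (E u)) ->
  0 <= h -> (forall u, (P (hat @^-1` E u) <= h%:E)%E) ->
  pairwise (apart d (M + M).+2) S ->
  (P (hat @^-1` (\big[setI/@Nconf R d]_(u <- S) E u)) <= (h ^+ size S)%:E)%E.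
Proof.
move=> fhat mhat fr s0 Ls mE EN lE h0 Eh; elim: S => [|u S IH] /=.
  rewrite big_nil expr0 => _; apply: probability_le1; apply: mhat.
  exact: Nmeasurable_conf.
case/andP=> /allP uS /IH{}IH; rewrite big_cons preimage_setI.
rewrite (finite_range_local _ _ _ _ _ _ L (block R d M s u)
   (\big[setU/set0]_(v <- S) block R d M s v)) //.
- by rewrite exprS EFinM; apply: lee_pmul.
- exact: borel_block.
- by apply: borel_bigsetU => v; exact: borel_block.
- move=> a b ua /in_bigsetU[v vS vb]; apply: le_trans Ls _.
  by apply: dist_block s0 (uS v vS) ua vb.
- exact: Nmeasurable_bigsetI.
- move=> xi B Nxi SB; split=> /in_bigsetI[_ xiS]; apply/in_bigsetI; split=> //.
  + move=> v vS; apply/(lE v xi B Nxi _); last exact: xiS.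
    by move=> y vy; apply: SB; apply/in_bigsetU; exists v.
  + exact: locally_finite_sub Nxi.
  + move=> v vS; apply/(lE v xi B Nxi _); last exact: xiS.
    by move=> y vy; apply: SB; apply/in_bigsetU; exists v.
Qed.

(** * ** Zero-one law for the empty configuration *)

Definition void_cube (R : realType) (d : nat) (s : R) (v : 'rV[int]_d) :=
  count_event R d [set y : 'rV[R]_d | cube R d s y = v] [set (0 : \bar R)].

Lemma void_cubeP (R : realType) (d : nat) (s : R) (v : 'rV[int]_d) xi :
  locally_finite xi -> void_cube R d s v xi <-> vacant R d s xi v.
Proof.
move=> fxi; split=> [[_ /counting_eq0 xi0] z xiz zv|xiv].
  by have : (set0 : set 'rV[R]_d) z by rewrite -xi0.
split=> //; apply/counting_eq0; apply/eqP/negPn/negP => /set0P[z [xiz]].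
exact: xiv.
Qed.

Lemma Nmeasurable_void_cube (R : realType) (d : nat) (s : R) (v : 'rV[int]_d) :
  0 < s -> Nmeasurable (void_cube R d s v).
Proof. by move=> s0; apply: Nmeasurable_count_event1; exact: borel_cube. Qed.

(** Emptiness, of probability [p], is the decreasing limit of the voids of growing central cubes. It
    also forces two distant cubes to be void, so [p] is at most the square of a void probability
    tending to [p]; hence [p] is 0 or 1. *)
Lemma void_or_dense (R : realType) (d : nat) (dO : measure_display)
    (Omega : measurableType dO) (P : probability Omega R)
    (hat : Omega -> set 'rV[R]_d) (L : R) :
  (0 < d)%N -> (forall w, locally_finite (hat w)) ->
  (forall E, Nmeasurable E -> measurable (hat @^-1` E)) ->
  stationary R d dO Omega P hat -> finite_range R d dO Omega P hat L ->
  (measurable [set w | hat w = set0] /\ P [set w | hat w = set0] = 1%E) \/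
  forall e : R, 0 < e -> exists s : R, [/\ 0 < s, L <= 2 * s &
    (P (hat @^-1` void_cube R d s 0%R) <= e%:E)%E].
Proof.
case: d hat => // d hat _ fhat mhat st fr.
pose E (n : nat) v := hat @^-1` void_cube R d.+1 n.+1%:R v.
have n0 (n : nat) : 0 < n.+1%:R :> R by rewrite ltr0n.
have mE n v : measurable (E n v) by apply: mhat; apply: Nmeasurable_void_cube.
have Ecap : \bigcap_n E n 0 = [set w | hat w = set0].
  apply/seteqP; split=> w => [Ew|/= w0 n _]; last first.
    by apply/void_cubeP => //; rewrite w0.
  apply/eqP/negPn/negP => /set0P[z wz].
  have /void_cubeP/(_ z wz) := Ew (Num.bound (euclid_dist z 0)) I.
  move=> /(_ (fhat w)); apply; apply/(cubeP _ _ _ _ _ (n0 _)) => i.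
  have := coord_le_dist _ _ z 0 i; rewrite !mxE subr0 mulr0 sub0r add0r.
  have : euclid_dist z 0 < (Num.bound (euclid_dist z 0)).+1%:R.
    by apply: lt_le_trans (archi_boundP _) _; rewrite ?sqrtr_ge0 // ler_nat.
  by rewrite ler_norml => h /andP[h1 h2]; apply/andP; split; lra.
have dE m n : (m <= n)%N -> E n 0 `<=` E m 0.
  move=> mn w /void_cubeP wn; apply/void_cubeP => // z wz zm.
  apply: (wn (fhat w) z wz); apply/(cubeP _ _ _ _ _ (n0 _)) => i.
  have /(cubeP _ _ _ _ _ (n0 _))/(_ i) := zm; rewrite !mxE mulr0 sub0r add0r.
  have : m.+1%:R <= n.+1%:R :> R by rewrite ler_nat.
  by move=> h /andP[h1 h2]; apply/andP; split; lra.
have mcap : measurable (\bigcap_n E n 0) by apply: bigcapT_measurable.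
set p := fine (P (\bigcap_n E n 0)).
have pE : P (\bigcap_n E n 0) = p%:E by rewrite /p fineK ?fin_num_measure.
have sq n : L <= 2 * n.+1%:R -> p <= fine (P (E n 0)) ^+ 2.
  (* Index 2 in each coordinate is the smallest gap accepted by [dist_block] for single cubes, that
     is for blocks of radius 0. *)
  move=> Ln; pose v : 'rV[int]_d.+1 := \row_i 2.
  have ind : P (E n 0 `&` E n v) = (P (E n 0%R) * P (E n v))%E.
    apply: (finite_range_local _ _ _ _ _ _ L (block R d.+1 0 n.+1%:R 0)
      (block R d.+1 0 n.+1%:R v)) => //.
    - exact: borel_block.
    - exact: borel_block.
    - move=> a b a0 bv; apply: le_trans Ln _; apply: dist_block (n0 _) _ a0 bv.
      by apply/existsP; exists ord0; rewrite !mxE.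
    - exact: Nmeasurable_void_cube.
    - exact: Nmeasurable_void_cube.
    - by apply: local_count_event => y /= <-; apply: within_refl.
    - by apply: local_count_event => y /= <-; apply: within_refl.
  have Ev : P (E n v) = P (E n 0).
    by apply: prob_cube_count => //; exact: Nmeasurable_void_cube.
  rewrite -lee_fin -pE expr2 EFinM !(fineK (fin_num_measure P _ (mE n _))).
  have -> : (P (E n 0%R) * P (E n 0%R))%E = P (E n 0%R `&` E n v) by rewrite ind Ev.
  apply: le_measure; rewrite ?inE //; first exact: measurableI.
  rewrite Ecap => w /= w0; split; apply/void_cubeP => //; rewrite w0 //.
have [n0L Ln0] : exists N, forall n, (N <= n)%N -> L <= 2 * n.+1%:R.
  exists (Num.bound `|L|) => n Nn; apply: le_trans (ler_norm _) _.
  apply/ltW/(lt_le_trans (archi_boundP _)) => //.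
  rewrite -natrM ler_nat mul2n -addnn.
  exact: leq_trans Nn (leq_trans (leqnSn n) (leq_addr _ _)).
have p0 : 0 <= p by apply: fine_ge0.
have p1 : p <= 1 by rewrite -lee_fin -pE probability_le1.
have large e : 0 < e -> exists n, L <= 2 * n.+1%:R /\ fine (P (E n 0)) < p + e.
  move=> e0; have [N HN] := prob_decreasing _ _ _ P _ e (mE^~ 0) dE e0.
  exists (maxn N n0L); split; first by apply: Ln0; rewrite leq_maxr.
  by apply: HN; rewrite leq_maxl.
have [p_0|p_neq0] := eqVneq p 0.
  right=> e /large[n [Ln]]; rewrite p_0 add0r => Een; exists n.+1%:R; split=> //.
  by rewrite -(fineK (fin_num_measure P _ (mE n 0))) lee_fin ltW.
have [p_1|p_neq1] := eqVneq p 1; first by left; rewrite -Ecap pE p_1.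
(* With [e = p * (1 - p) / 4] one gets [(p + e) ^ 2 <= p ^ 2 + 3 * e < p ^ 2 + 4 * e = p], which
   contradicts [p <= a ^+ 2 <= (p + e) ^+ 2]. *)
exfalso; have e0 : 0 < p * (1 - p) / 4.
  by rewrite !mulr_gt0 // ?invr_gt0 // ?subr_gt0 lt_neqAle ?p1 ?andbT // eq_sym p_neq0.
have [n [/sq sqn en]] := large _ e0.
have a0 : 0 <= fine (P (E n 0)) by apply: fine_ge0.
move: sqn en a0; set a := fine _; set e := p * _ / 4 => sqn en a0.
have : a ^+ 2 <= (p + e) ^+ 2 by rewrite ler_pXn2r ?nnegrE // ?addr_ge0 // ltW.
have e1 : e <= 1 by rewrite /e; nra.
have : e * 4 = p * (1 - p) by rewrite /e; field.
by move: e0; rewrite -/e; nra.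
Qed.

(** * Irregular cubes *)

(** The complement of the finite list of counts from 1 to [N] covers empty and overcrowded cubes at
    once, in a form whose measurability is immediate. *)
Definition irregular (R : realType) (d N : nat) (s : R) (v : 'rV[int]_d) :
    set (set 'rV[R]_d) :=
  count_event R d [set y | cube R d s y = v]
    (~` [set k | k \in [seq j%:R%:E : \bar R | j <- iota 1 N]]).

Definition irregular_near (R : realType) (d M N : nat) (s : R) (u : 'rV[int]_d) :
    set (set 'rV[R]_d) :=
  \big[setU/set0]_(v <- nbrs d M u) irregular R d N s v.

Lemma Nmeasurable_irregular (R : realType) (d N : nat) (s : R) (v : 'rV[int]_d) :
  0 < s -> Nmeasurable (irregular R d N s v).
Proof.
move=> s0; apply: Nmeasurable_count_eventC; apply: Nmeasurable_count_event_seq.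
exact: borel_cube.
Qed.

Lemma Nmeasurable_irregular_near (R : realType) (d M N : nat) (s : R) (u : 'rV[int]_d) :
  0 < s -> Nmeasurable (irregular_near R d M N s u).
Proof.
by move=> s0; apply: Nmeasurable_bigsetU => v; exact: Nmeasurable_irregular.
Qed.

Lemma irregular_near_conf (R : realType) (d M N : nat) (s : R) (u : 'rV[int]_d) :
  irregular_near R d M N s u `<=` @Nconf R d.
Proof. by move=> xi /in_bigsetU[v _ []]. Qed.

Lemma local_irregular_near (R : realType) (d M N : nat) (s : R) (u : 'rV[int]_d) :
  local_event R d (block R d M s u) (irregular_near R d M N s u).
Proof.
move=> xi B Nxi uB.
have loc v : v \in nbrs d M u -> irregular R d N s v (xi `&` B) <-> irregular R d N s v xi.
  move=> vu; apply: (local_count_event _ _ _ (block R d M s u)) => // y /= yv.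
  by rewrite /block /= yv -mem_nbrs.
by split=> /in_bigsetU[v vu h]; apply/in_bigsetU; exists v => //; apply/(loc v vu).
Qed.

Lemma regular_points (R : realType) (d N : nat) (s : R) (v : 'rV[int]_d) xi :
  locally_finite xi -> ~ irregular R d N s v xi ->
  ~ vacant R d s xi v /\ exists l : seq 'rV[R]_d,
    (size l <= N)%N /\ forall x, x \in l <-> xi x /\ cube R d s x = v.
Proof.
move=> fxi reg.
have : npts xi [set y | cube R d s y = v] \in [seq j%:R%:E : \bar R | j <- iota 1 N].
  by apply: contrapT => h; apply: reg; split.
case/mapP=> j; rewrite mem_iota add1n ltnS => /andP[j1 jN] /counting_natP[l [lj lv]].
split; last by exists l; rewrite lj.
move=> vac; move: j1; rewrite -lj; case: l lj lv => // x l _ lv _.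
by have [xix xv] := (lv x).1 (mem_head _ _); apply: vac xv.
Qed.

(** An irregular cube is void or holds more than [N] points. The latter event decreases to the empty
    set as [N] grows, by local finiteness, so each alternative can be given half of [e]. *)
Lemma prob_irregular_small (R : realType) (d : nat) (dO : measure_display)
    (Omega : measurableType dO) (P : probability Omega R)
    (hat : Omega -> set 'rV[R]_d) (s e : R) :
  (forall w, locally_finite (hat w)) ->
  (forall E, Nmeasurable E -> measurable (hat @^-1` E)) ->
  0 < s -> 0 < e -> (P (hat @^-1` void_cube R d s 0%R) <= (e / 2)%:E)%E ->
  exists N : nat, (P (hat @^-1` irregular R d N s 0%R) <= e%:E)%E.
Proof.
move=> fhat mhat s0 e0 void.
(* Here the list starts at 0, so [F N] is overcrowding alone. *)
pose W (N : nat) : set (\bar R) := ~` [set k | k \in [seq j%:R%:E : \bar R | j <- iota 0 N.+1]].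
pose F N := hat @^-1` count_event R d [set y | cube R d s y = 0%R] (W N).
have nF N : Nmeasurable (count_event R d [set y | cube R d s y = 0%R] (W N)).
  apply: Nmeasurable_count_eventC; apply: Nmeasurable_count_event_seq.
  exact: borel_cube.
have mF N : measurable (F N) by apply: mhat.
have dF m n : (m <= n)%N -> F n `<=` F m.
  move=> mn w [Nw Ww]; split=> // /mapP[j]; rewrite mem_iota add0n => jm e'.
  apply: Ww; apply/mapP; exists j => //; rewrite mem_iota add0n.
  by apply: leq_trans jm _; rewrite ltnS.
have capF : \bigcap_n F n = set0.
  apply/eqP/negPn/negP => /set0P[w Fw].
  have fin : finite_set (hat w `&` [set y | cube R d s y = 0%R]).
    apply: sub_finite_set (finite_cubes R d 0 s _ 0%R s0 (fhat w)) => y [wy /= y0].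
    by split=> //=; rewrite y0; apply: within_refl.
  have [_ /=] := Fw (size (finmap.enum_fset
    (fset_set (hat w `&` [set y | cube R d s y = 0%R])))) I.
  apply; apply/mapP; eexists; last by rewrite /npts /counting asboolT.
  by rewrite mem_iota /=.
have [N HN] := prob_decreasing _ _ _ P F (e / 2) mF dF (divr_gt0 e0 (ltr0n _ 2)).
exists N.
have mv : measurable (hat @^-1` void_cube R d s 0%R).
  by apply: mhat; exact: Nmeasurable_void_cube.
have sub : hat @^-1` irregular R d N s 0%R `<=` hat @^-1` void_cube R d s 0%R `|` F N.
  move=> w [Nw Ww].
  have [w0|w0] := pselect (npts (hat w) [set y | cube R d s y = 0%R] = 0%E :> \bar R).
    by left.
  right; split=> // /mapP[[|j]]; first by move=> _ /w0.
  rewrite mem_iota add0n ltnS /= => jN wj; apply: Ww; apply/mapP; exists j.+1 => //.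
  by rewrite mem_iota add1n ltnS.
apply: le_trans (le_measure _ _ _ sub) _; rewrite ?inE.
- by apply: mhat; exact: Nmeasurable_irregular.
- exact: measurableU.
apply: le_trans (measureU2 _ mv (mF N)) _.
rewrite [e]splitr EFinD; apply: leeD => //.
have := HN N (leqnn N); rewrite capF measure0 /= add0r => /ltW.
by rewrite -lee_fin fineK ?fin_num_measure.
Qed.

Lemma prob_irregular_near (R : realType) (d M N : nat) (dO : measure_display)
    (Omega : measurableType dO) (P : probability Omega R)
    (hat : Omega -> set 'rV[R]_d) (s e : R) u :
  (forall E, Nmeasurable E -> measurable (hat @^-1` E)) ->
  stationary R d dO Omega P hat ->
  0 < s -> (P (hat @^-1` irregular R d N s 0%R) <= e%:E)%E ->
  (P (hat @^-1` irregular_near R d M N s u) <= (((M + M).+1 ^ d)%:R * e)%:E)%E.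
Proof.
move=> mhat st s0 small; rewrite -(size_nbrs d M u).
have -> : hat @^-1` irregular_near R d M N s u =
    \big[setU/set0]_(v <- nbrs d M u) (hat @^-1` irregular R d N s v).
  by apply/seteqP; split=> w /in_bigsetU h; apply/in_bigsetU.
apply: measure_bigsetU_le => v _.
  by apply: mhat; exact: Nmeasurable_irregular.
rewrite prob_cube_count //; exact: Nmeasurable_irregular.
Qed.

(** * ** Counting sets of distant sites along walks *)

Definition apart_sublists (d M k n m : nat) (u : 'rV[int]_d) : seq (seq 'rV[int]_d) :=
  [seq S <- flatten [seq [seq mask b p | b : n.-tuple bool] | p <- walks d M n u]
     | pairwise (apart d k) S && (size S == m)].

Lemma mem_apart_sublists (d M k n m : nat) (u : 'rV[int]_d) p S :
  p \in walks d M n u -> subseq S p -> pairwise (apart d k) S -> size S = m ->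
  S \in apart_sublists d M k n m u.
Proof.
move=> pw /subseqP[b sb Sb] aS sS; rewrite mem_filter aS sS eqxx /=.
apply/flatten_mapP; exists p => //.
have bn : size b == n by rewrite sb; move: pw; rewrite mem_walks => /andP[].
by apply/mapP; exists (Tuple bn); rewrite ?mem_enum.
Qed.

Lemma apart_sublistsP (d M k n m : nat) (u : 'rV[int]_d) S :
  S \in apart_sublists d M k n m u -> pairwise (apart d k) S /\ size S = m.
Proof. by rewrite mem_filter => /andP[/andP[? /eqP ?] _]. Qed.

(** Each of the [n] steps has [(M + M).+1 ^ d] choices, and a mask keeps or drops each visited
    site. *)
Lemma size_apart_sublists (d M k n m : nat) (u : 'rV[int]_d) :
  (size (apart_sublists d M k n m u) <= (((M + M).+1 ^ d) * 2) ^ n)%N.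
Proof.
rewrite size_filter; apply: leq_trans (count_size _ _) _.
rewrite size_flatten /shape -map_comp.
rewrite (_ : map _ _ = nseq (size (walks d M n u)) (2 ^ n)%N).
  by rewrite sumn_nseq size_walks -expnMn mulnC.
elim: (walks d M n u) => //= p l ->; congr cons.
by rewrite size_image card_tuple card_bool.
Qed.

(** * Short open edges *)

(** Edges are oriented and filed under the cube of their first endpoint, so a short undirected edge
    is seen from the cubes of both its ends. *)
Definition short_edge (R : realType) (d M : nat) (s : R) (xi : set 'rV[R]_d)
    (u : 'rV[int]_d) (e : 'rV[R]_d * 'rV[R]_d) : Prop :=
  [/\ DT xi e.1 e.2, cube R d s e.1 = u & within d M u (cube R d s e.2)].

Definition open_near (R : realType) (d M : nat) (s : R) (xi : set 'rV[R]_d) (T : Type)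
    (K : 'rV[R]_d -> 'rV[R]_d -> set T) (u : 'rV[int]_d) : set T :=
  [set q | exists2 e, short_edge R d M s xi u e & K e.1 e.2 q].

(** Without irregular cubes nearby there are at most [N] choices for the first endpoint, and at most
    [N] in each of the [(M + M).+1 ^ d] cubes for the second. *)
Lemma short_edges_seq (R : realType) (d M N : nat) (s : R) (xi : set 'rV[R]_d) u :
  locally_finite xi -> ~ irregular_near R d M N s u xi ->
  exists l : seq ('rV[R]_d * 'rV[R]_d),
    (size l <= (M + M).+1 ^ d * (N * N))%N /\
    forall e, e \in l <-> short_edge R d M s xi u e.
Proof.
move=> fxi reg.
have /choice[L HL] v : exists l : seq 'rV[R]_d, v \in nbrs d M u ->
    (size l <= N)%N /\ forall x, x \in l <-> xi x /\ cube R d s x = v.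
  have [vu|] := boolP (v \in nbrs d M u); last by exists [::].
  have [] := @regular_points R d N s v xi fxi.
    by move=> h; apply: reg; apply/in_bigsetU; exists v.
  by move=> _ [l lP]; exists l.
have uu : u \in nbrs d M u by rewrite mem_nbrs within_refl.
pose l0 := [seq (x, y) | x <- L u, y <- flatten [seq L v | v <- nbrs d M u]].
exists [seq e <- l0 | `[< short_edge R d M s xi u e >]]; split.
  rewrite size_filter; apply: leq_trans (count_size _ _) _.
  rewrite size_allpairs mulnA [X in (_ <= X)%N]mulnC.
  apply: leq_mul; first by have [] := HL u uu.
  rewrite -(size_nbrs d M u); elim: (nbrs d M u) (fun v (h : v \in nbrs d M u) => (HL v h).1) => //.
  move=> v l IH lN /=; rewrite size_cat mulSn; apply: leq_add.
    by apply: lN; rewrite inE eqxx.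
  by apply: IH => w wl; apply: lN; rewrite inE wl orbT.
move=> e; rewrite mem_filter; split=> [/andP[/asboolP]|eS] //.
apply/andP; split; first exact/asboolP.
have [[xie1 xie2 _ _] e1 e2] := eS; case: e eS e1 e2 xie1 xie2 => x y /= eS e1 e2 xix xiy.
have e2' : cube R d s y \in nbrs d M u by rewrite mem_nbrs.
apply/allpairsP; exists (x, y); split=> //=; first by apply/(HL u uu).2.
by apply/flatten_mapP; exists (cube R d s y) => //; apply/(HL _ e2').2.
Qed.

Lemma apart_neq (d k : nat) (u v w : 'rV[int]_d) (M : nat) :
  (M < k)%N -> apart d k u v -> within d M u w -> w != v.
Proof.
move=> Mk /existsP[i uv] /forallP/(_ i) uw; apply/eqP => wv.
by move: uv uw; rewrite wv; lia.
Qed.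

(* [es] collects the edges picked so far by the union bound over the sites of [S]; they
   are distinct as unordered pairs because their sites are apart. *)
Lemma prob_open_apart (R : realType) (d M N : nat) (s a : R) (xi : set 'rV[R]_d)
    (dT : measure_display) (T : measurableType dT) (Q : probability T R)
    (K : 'rV[R]_d -> 'rV[R]_d -> set T) (es : seq ('rV[R]_d * 'rV[R]_d))
    (S : seq 'rV[int]_d) :
  locally_finite xi -> 0 <= a ->
  (forall x y, measurable (K x y)) -> edges_indep Q (DT xi) K ->
  (forall x y, DT xi x y -> (Q (K x y) <= a%:E)%E) ->
  (forall e, e \in es -> short_edge R d M s xi (cube R d s e.1) e) ->
  (forall u, u \in S -> ~ irregular_near R d M N s u xi) ->
  pairwise (apart d (M + M).+2) (map (fun e => cube R d s e.1) es ++ S) ->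
  measurable (\big[setI/(\big[setI/setT]_(e <- es) K e.1 e.2)]_(u <- S)
     open_near R d M s xi T K u) /\
  (Q (\big[setI/(\big[setI/setT]_(e <- es) K e.1 e.2)]_(u <- S)
     open_near R d M s xi T K u) <=
   (a ^+ size es * ((((M + M).+1 ^ d * (N * N))%:R) * a) ^+ size S)%:E)%E.
Proof.
move=> fxi a0 mK indQ Qa; elim: S es => [|u S IH] es esP SP ap.
  rewrite big_nil expr0 mulr1; split.
    by apply: big_ind => // A B mA mB; exact: measurableI.
  rewrite indQ; first last.
  - move: ap; rewrite cats0 pairwise_map; apply: (@sub_in_pairwise _ [in es]) (allss es).
    move=> e f ees fes /= ef; have [_ _ e12] := esP e ees.
    (* If [f] were [e], their sites would coincide; if [f] were [e] reversed, its site would be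
       within [M] of that of [e]. Both contradict apartness. *)
    apply/negP => /orP[/eqP fe|/eqP fe].
      by move: (apart_neq _ _ _ _ _ 0 (ltn0Sn _) ef (within_refl _ _ _)); rewrite fe eqxx.
    have M2 : (M < (M + M).+2)%N.
      by rewrite ltnS; apply: leq_trans (leq_addr _ _) (leqnSn _).
    by move: (apart_neq _ _ _ _ _ M M2 ef e12); rewrite fe eqxx.
  - by move=> e /esP[].
  elim: es esP {ap} => [|e es IHes] esP; first by rewrite big_nil.
  rewrite big_cons /= exprS EFinM; apply: lee_pmul => //.
  - by rewrite prode_ge0.
  - by apply: Qa; have [] := esP e (mem_head _ _).
  - by apply: IHes => f fes; apply: esP; rewrite inE fes orbT.
have [l [lsize lP]] := short_edges_seq R d M N s xi u fxi (SP u (mem_head _ _)).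
pose F e := \big[setI/(\big[setI/setT]_(f <- rcons es e) K f.1 f.2)]_(v <- S)
  open_near R d M s xi T K v.
(* Openness near [u] is split over its finitely many short edges, and the chosen edge joins [es].
   Appending it at the end keeps the combined list of sites in the same order. *)
have E : \big[setI/(\big[setI/setT]_(e <- es) K e.1 e.2)]_(v <- u :: S)
    open_near R d M s xi T K v = \big[setU/set0]_(e <- l) F e.
  apply/seteqP; split=> q.
    case/in_bigsetI => /in_bigsetI[_ qes] qS.
    have [e eu qe] := qS u (mem_head _ _).
    apply/in_bigsetU; exists e; first exact/lP.
    apply/in_bigsetI; split.
      apply/in_bigsetI; split=> // f; rewrite mem_rcons inE => /orP[/eqP -> //|].
      exact: qes.
    by move=> v vS; apply: qS; rewrite inE vS orbT.
  case/in_bigsetU => e /lP eu /in_bigsetI[/in_bigsetI[_ qes] qS].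
  apply/in_bigsetI; split.
    by apply/in_bigsetI; split=> // f fes; apply: qes; rewrite mem_rcons inE fes orbT.
  move=> v; rewrite inE => /orP[/eqP ->|/qS //].
  by exists e => //; apply: qes; rewrite mem_rcons inE eqxx.
have FP e : e \in l -> measurable (F e) /\ (Q (F e) <= (a ^+ (size es).+1 *
    (((M + M).+1 ^ d * (N * N))%:R * a) ^+ size S)%:E)%E.
  move=> /lP eu; rewrite -(size_rcons es e); apply: IH.
  - move=> f; rewrite mem_rcons inE => /orP[/eqP ->|/esP //].
    by have [_ e1 _] := eu; rewrite e1.
  - by move=> v vS; apply: SP; rewrite inE vS orbT.
  - by have [_ e1 _] := eu; rewrite map_rcons e1 cat_rcons.
rewrite E; split.
  rewrite big_seq; apply: big_ind => // [A B|e el]; first exact: measurableU.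
  by have [] := FP e el.
apply: le_trans (measure_bigsetU_le _ _ _ Q _ l F _
   (fun e el => (FP e el).1) (fun e el => (FP e el).2)) _.
rewrite lee_fin [size (u :: S)]/= !exprS.
set D := ((M + M).+1 ^ d * (N * N))%N in lsize *.
have -> : a ^+ size es * (D%:R * a * (D%:R * a) ^+ size S) =
  D%:R * (a * a ^+ size es * (D%:R * a) ^+ size S) by ring.
by rewrite ler_wpM2r ?ler_nat // !mulr_ge0 // ?exprn_ge0 // mulr_ge0.
Qed.

(** * Long bad walks *)

Lemma vacant_irregular (R : realType) (d N : nat) (s : R) (xi : set 'rV[R]_d) v :
  locally_finite xi -> vacant R d s xi v -> irregular R d N s v xi.
Proof.
move=> fxi /(void_cubeP R d s v xi fxi)[_ /= xi0]; split=> //=; rewrite xi0.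
case/mapP => j; rewrite mem_iota => /andP[j0 _] [/eqP].
by rewrite eq_sym pnatr_eq0 => /eqP j0'; rewrite j0' in j0.
Qed.

Lemma infinite_cluster_bad (R : realType) (d N n : nat) (s : R) (xi : set 'rV[R]_d)
    (T : Type) (K : 'rV[R]_d -> 'rV[R]_d -> set T) (q : T) (x : 'rV[R]_d) :
  let M := (d.+1 + d.+1)%N in
  0 < s -> locally_finite xi -> xi x -> (forall a b, K a b = K b a) ->
  ~ finite_set (dt_cluster xi K q x) ->
  exists p, [/\ p \in walks d M n (cube R d s x), uniq p & forall v, v \in p ->
    irregular_near R d M N s v xi \/ open_near R d M s xi T K v q].
Proof.
move=> M s0 fxi xix Ksym.
apply: (infinite_cluster_walk R d M n s xi
  [set v | irregular_near R d M N s v xi \/ open_near R d M s xi T K v q]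
  (fun a b => DT xi a b /\ K a b q)) => //.
move=> a b [DTab Kab]; have [xia xib ab [F [Fa Fb Fd]]] := DTab.
have DTba : DT xi b a by split=> //; [exact/nesym|exists F].
split=> //; apply: (DT_linked R d s xi) => // [v v' vac vv'|near_ab].
  left; apply/in_bigsetU; exists v; first by rewrite mem_nbrs within_sym.
  exact: vacant_irregular.
have ba : within d M (cube R d s b) (cube R d s a) by rewrite within_sym.
(* A short open edge makes both its cubes open: the reversed edge is used for the second one, by
   symmetry of [K]. *)
split; right; [exists (a, b)|exists (b, a)]; rewrite ?[K b a]Ksym //; exact: And3.
Qed.

(* With this length, pigeonhole modulo [(M + M).+2] extracts [m] pairwise apart sites
   from the irregular half or from the regular half of the walk. *)
Definition walk_length (d M m : nat) : nat := (2 * ((M + M).+2 ^ d * m))%N.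

Definition irregular_cluster (R : realType) (d M N m : nat) (s : R) (u : 'rV[int]_d) :
    set (set 'rV[R]_d) :=
  \big[setU/set0]_(S <- apart_sublists d M (M + M).+2 (walk_length d M m) m u)
    \big[setI/@Nconf R d]_(v <- S) irregular_near R d M N s v.

(** The filter keeps only sites with no irregular cube nearby, where the number of short edges is
    under control. *)
Definition open_cluster (R : realType) (d M N m : nat) (s : R) (xi : set 'rV[R]_d)
    (T : Type) (K : 'rV[R]_d -> 'rV[R]_d -> set T) (u : 'rV[int]_d) : set T :=
  \big[setU/set0]_(S <- [seq S <- apart_sublists d M (M + M).+2 (walk_length d M m) m u
      | `[< forall v, v \in S -> ~ irregular_near R d M N s v xi >]])
    \big[setI/setT]_(v <- S) open_near R d M s xi T K v.

Lemma bad_walk_cluster (R : realType) (d M N m : nat) (s : R) (xi : set 'rV[R]_d)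
    (T : Type) (K : 'rV[R]_d -> 'rV[R]_d -> set T) (q : T) (u : 'rV[int]_d) p :
  locally_finite xi -> p \in walks d M (walk_length d M m) u -> uniq p ->
  (forall v, v \in p ->
    irregular_near R d M N s v xi \/ open_near R d M s xi T K v q) ->
  irregular_cluster R d M N m s u xi \/ open_cluster R d M N m s xi T K u q.
Proof.
move=> fxi pw up bad; pose H v := `[< irregular_near R d M N s v xi >].
have sp : size p = walk_length d M m by move: pw; rewrite mem_walks => /andP[_ /eqP].
have [cH|cH] := leqP ((M + M).+2 ^ d * m) (count H p).
  left; have [S [Sp HS aS sS]] := pigeonhole_apart _ _ _ _ _ up cH.
  apply/in_bigsetU; exists S; first exact: mem_apart_sublists pw Sp aS sS.
  by apply/in_bigsetI; split=> // v vS; apply/asboolP; exact: (allP HS).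
have cN : ((M + M).+2 ^ d * m <= count (predC H) p)%N.
  move: (count_predC H p); rewrite sp /walk_length; lia.
right; have [S [Sp HS aS sS]] := pigeonhole_apart _ _ _ _ _ up cN.
have reg v : v \in S -> ~ irregular_near R d M N s v xi.
  by move=> /(allP HS)/= /negP nH h; apply: nH; exact/asboolP.
apply/in_bigsetU; exists S.
  by rewrite mem_filter (mem_apart_sublists _ _ _ _ _ _ _ _ pw Sp aS sS) andbT; apply/asboolP.
apply/in_bigsetI; split=> // v vS.
by case: (bad v (mem_subseq Sp vS)) => // /(reg v vS).
Qed.

(** Since [walk_length] is linear in [m], the number of sublists grows at most geometrically in [m];
    this is the ratio. *)
Definition walk_weight (R : realType) (d M : nat) : R :=
  ((((M + M).+1 ^ d * 2) ^ (2 * (M + M).+2 ^ d))%:R).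

Lemma size_apart_sublists_weight (R : realType) (d M m : nat) (u : 'rV[int]_d) :
  ((size (apart_sublists d M (M + M).+2 (walk_length d M m) m u))%:R : R) <=
  walk_weight R d M ^+ m.
Proof.
rewrite /walk_weight -natrX ler_nat -expnM -mulnA; exact: size_apart_sublists.
Qed.

Lemma Nmeasurable_irregular_cluster (R : realType) (d M N m : nat) (s : R) u :
  0 < s -> Nmeasurable (irregular_cluster R d M N m s u).
Proof.
move=> s0; apply: Nmeasurable_bigsetU => S; apply: Nmeasurable_bigsetI.
  by move=> v; exact: irregular_near_conf.
by move=> v; exact: Nmeasurable_irregular_near.
Qed.

Lemma prob_irregular_cluster (R : realType) (d M N m : nat) (dO : measure_display)
    (Omega : measurableType dO) (P : probability Omega R)
    (hat : Omega -> set 'rV[R]_d) (L s h : R) u :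
  (forall w, locally_finite (hat w)) ->
  (forall E, Nmeasurable E -> measurable (hat @^-1` E)) ->
  finite_range R d dO Omega P hat L -> 0 < s -> L <= 2 * s -> 0 <= h ->
  (forall u, (P (hat @^-1` irregular_near R d M N s u) <= h%:E)%E) ->
  (P (hat @^-1` irregular_cluster R d M N m s u) <= ((walk_weight R d M * h) ^+ m)%:E)%E.
Proof.
move=> fhat mhat fr s0 Ls h0 Hh.
set L0 := apart_sublists d M (M + M).+2 (walk_length d M m) m u.
have -> : hat @^-1` irregular_cluster R d M N m s u = \big[setU/set0]_(S <- L0)
    (hat @^-1` \big[setI/@Nconf R d]_(v <- S) irregular_near R d M N s v).
  by apply/seteqP; split=> w /in_bigsetU h'; apply/in_bigsetU.
apply: le_trans (measure_bigsetU_le _ _ _ P _ L0 _ (h ^+ m) _ _) _.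
- move=> S _; apply: mhat; apply: Nmeasurable_bigsetI => v.
    exact: irregular_near_conf.
  exact: Nmeasurable_irregular_near.
- move=> S /apart_sublistsP[aS <-].
  apply: (prob_apart R d M _ _ _ _ L s) => //.
  + by move=> v; exact: Nmeasurable_irregular_near.
  + by move=> v; exact: irregular_near_conf.
  + by move=> v; exact: local_irregular_near.
by rewrite lee_fin exprMn ler_wpM2r ?exprn_ge0 // size_apart_sublists_weight.
Qed.

Lemma prob_open_cluster (R : realType) (d M N m : nat) (s a : R) (xi : set 'rV[R]_d)
    (dT : measure_display) (T : measurableType dT) (Q : probability T R)
    (K : 'rV[R]_d -> 'rV[R]_d -> set T) u :
  locally_finite xi -> 0 <= a ->
  (forall x y, measurable (K x y)) -> edges_indep Q (DT xi) K ->
  (forall x y, DT xi x y -> (Q (K x y) <= a%:E)%E) ->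
  measurable (open_cluster R d M N m s xi T K u) /\
  (Q (open_cluster R d M N m s xi T K u) <=
   ((walk_weight R d M * (((M + M).+1 ^ d * (N * N))%:R * a)) ^+ m)%:E)%E.
Proof.
move=> fxi a0 mK indQ Qa; rewrite /open_cluster.
set L0 := [seq S <- _ | _]; set D := ((M + M).+1 ^ d * (N * N))%N.
have SP S : S \in L0 ->
    measurable (\big[setI/setT]_(v <- S) open_near R d M s xi T K v) /\
    (Q (\big[setI/setT]_(v <- S) open_near R d M s xi T K v) <= ((D%:R * a) ^+ m)%:E)%E.
  rewrite mem_filter => /andP[/asboolP reg /apart_sublistsP[aS sS]].
  have := prob_open_apart R d M N s a xi dT T Q K [::] S fxi a0 mK indQ Qa.
  by rewrite big_nil expr0 mul1r sS; apply.
split.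
  rewrite big_seq; apply: big_ind => // [A B|S SL]; first exact: measurableU.
  by have [] := SP S SL.
apply: le_trans (measure_bigsetU_le _ _ _ Q _ L0 _ ((D%:R * a) ^+ m) _ _) _.
- by move=> S /SP[].
- by move=> S /SP[].
rewrite lee_fin [leRHS]exprMn ler_wpM2r ?exprn_ge0 ?mulr_ge0 //.
apply: le_trans (size_apart_sublists_weight R d M m u).
by rewrite ler_nat size_filter count_size.
Qed.

(** * ** Almost sure absence of long bad walks *)

Lemma expr_half_small (R : realType) (e : R) : 0 < e ->
  exists m0, forall m, (m0 <= m)%N -> (2^-1 : R) ^+ m <= e.
Proof.
move=> e0; exists (Num.bound e^-1) => m em.
rewrite exprVn invf_ple ?posrE ?exprn_gt0 //.
apply/ltW/(lt_le_trans (archi_boundP _)); first by rewrite invr_ge0 ltW.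
by rewrite -natrX ler_nat (leq_trans em) // ltnW // ltn_expl.
Qed.

(** An infinite cluster starting in cube [u] forces [open_cluster] for every [m] without
    [irregular_cluster]. Such [m] are arbitrarily large and the probability is at most [2^-1 ^+ m];
    there are countably many [u]. *)
Lemma finite_clusters_ae (R : realType) (d N : nat) (s a : R) (xi : set 'rV[R]_d)
    (dT : measure_display) (T : measurableType dT) (Q : probability T R)
    (K : 'rV[R]_d -> 'rV[R]_d -> set T) :
  let M := (d.+1 + d.+1)%N in
  0 < s -> locally_finite xi -> 0 <= a ->
  walk_weight R d M * (((M + M).+1 ^ d * (N * N))%:R * a) <= 2^-1 ->
  (forall u m0, exists2 m, (m0 <= m)%N & ~ irregular_cluster R d M N m s u xi) ->
  (forall x y, measurable (K x y)) -> (forall x y, K x y = K y x) ->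
  edges_indep Q (DT xi) K ->
  (forall x y, DT xi x y -> (Q (K x y) <= a%:E)%E) ->
  {ae Q, forall q, forall x, xi x -> finite_set (dt_cluster xi K q x)}.
Proof.
move=> M s0 fxi a0 small reg mK Ksym indQ Qa.
pose Z u : set T := [set q | forall m, ~ irregular_cluster R d M N m s u xi ->
  open_cluster R d M N m s xi T K u q].
apply: (@negligibleS _ _ _ _ (\bigcup_u Z u)).
  move=> q /existsNP[x /not_implyP[xix inf]].
  exists (cube R d s x) => // m nirr.
  have [p [pw up bad]] :=
    infinite_cluster_bad R d N (walk_length d M m) s xi T K q x s0 fxi xix Ksym inf.
  by have [] := bad_walk_cluster _ _ _ _ _ _ _ _ _ _ _ _ fxi pw up bad.
apply: negligible_bigcup_count => u; apply: negligible_small => e e0.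
have [m0 Hm0] := expr_half_small R e e0.
have [m mm0 nirr] := reg u m0.
have [mV QV] := prob_open_cluster R d M N m s a xi dT T Q K u fxi a0 mK indQ Qa.
exists (open_cluster R d M N m s xi T K u); split=> //; first by move=> q; apply.
apply: le_trans QV _; rewrite lee_fin; apply: le_trans (Hm0 m mm0).
rewrite lerXn2r // ?nnegrE ?invr_ge0 //.
by rewrite !mulr_ge0.
Qed.

(** Failure at [(u, m0)] lies in the irregular event of every single [m >= m0], of probability at
    most [2^-1 ^+ m]. Only countably many pairs occur. *)
Lemma regular_ae (R : realType) (d M N : nat) (dO : measure_display)
    (Omega : measurableType dO) (P : probability Omega R)
    (hat : Omega -> set 'rV[R]_d) (L s h : R) :
  (forall w, locally_finite (hat w)) ->
  (forall E, Nmeasurable E -> measurable (hat @^-1` E)) ->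
  finite_range R d dO Omega P hat L -> 0 < s -> L <= 2 * s -> 0 <= h ->
  walk_weight R d M * h <= 2^-1 ->
  (forall u, (P (hat @^-1` irregular_near R d M N s u) <= h%:E)%E) ->
  {ae P, forall w, forall u m0,
     exists2 m, (m0 <= m)%N & ~ irregular_cluster R d M N m s u (hat w)}.
Proof.
move=> fhat mhat fr s0 Ls h0 small Hh.
pose Z (um : 'rV[int]_d * nat) : set Omega :=
  [set w | forall m, (um.2 <= m)%N -> irregular_cluster R d M N m s um.1 (hat w)].
apply: (@negligibleS _ _ _ _ (\bigcup_um Z um)).
  move=> w /existsNP[u /existsNP[m0 irr]]; exists (u, m0) => // m /= mm0.
  by apply: contrapT => nirr; apply: irr; exists m.
apply: negligible_bigcup_count => -[u m0]; apply: negligible_small => e e0.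
have [m1 Hm1] := expr_half_small R e e0; set m := maxn m0 m1.
exists (hat @^-1` irregular_cluster R d M N m s u); split.
- by apply: mhat; exact: Nmeasurable_irregular_cluster.
- by move=> w; apply; exact: leq_maxl.
apply: le_trans (prob_irregular_cluster R d M N m _ _ P hat L s h u
  fhat mhat fr s0 Ls h0 Hh) _.
rewrite lee_fin; apply: le_trans (Hm1 m (leq_maxr _ _)).
by rewrite lerXn2r // ?nnegrE ?invr_ge0 // mulr_ge0.
Qed.

(** * ** Choice of the scale, the crowding threshold and the time *)

Theorem theorem6p2 (R : realType) (d : nat)
  (dO : measure_display) (Omega : measurableType dO) (P : probability Omega R)
  (hat : Omega -> set 'rV[R]_d)
  (co : Omega -> 'rV[R]_d -> 'rV[R]_d -> R)
  (C : R) :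
  (* omega |-> hat omega is a point process with values in N *)
  (forall w, locally_finite (hat w)) ->
  (forall E, Nmeasurable E -> measurable (hat @^-1` E)) ->
  (* its law is stationary *)
  (forall (x : 'rV[R]_d) E, Nmeasurable E ->
     P (hat @^-1` tauE x E) = P (hat @^-1` E)) ->
  (* finite intensity *)
  (\int[P]_w npts (hat w) [set y : 'rV[R]_d | forall i, (0 <= y ord0 i <= 1)%R]
     < +oo)%E ->
  (* non-negative conductances on the Delaunay edges *)
  (forall w x y, DT (hat w) x y -> 0 <= co w x y) ->
  (* finite range of dependence *)
  (exists L : R, 0 < L /\
     forall A B : set 'rV[R]_d, borelRd A -> borelRd B ->
       (forall a b, A a -> B b -> L <= euclid_dist a b) ->
       forall E1 E2, Nmeasurable E1 -> Nmeasurable E2 ->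
         P (hat @^-1` [set xi | E1 (xi `&` A)] `&`
            hat @^-1` [set xi | E2 (xi `&` B)]) =
         (P (hat @^-1` [set xi | E1 (xi `&` A)]) *
          P (hat @^-1` [set xi | E2 (xi `&` B)]))%E) ->
  (* uniformly bounded conductances c = c^o_{x,y} + c^o_{y,x} *)
  0 < C ->
  {ae P, forall w, forall x y, DT (hat w) x y -> co w x y + co w y x <= C} ->
  (* Assumption SEP *)
  {ae P, forall w, exists t0 : R, 0 < t0 /\
     forall (dT : measure_display) (T : measurableType dT) (Q : probability T R)
            (K : 'rV[R]_d -> 'rV[R]_d -> set T),
       (forall x y, measurable (K x y)) ->
       (forall x y, K x y = K y x) ->
       edges_indep Q (DT (hat w)) K ->
       (forall x y, DT (hat w) x y ->
          Q (K x y) = (1 - expR (- (t0 * (co w x y + co w y x))))%:E) ->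
       {ae Q, forall q, forall x, hat w x -> finite_set (dt_cluster (hat w) K q x)}}.
Proof.
move=> fhat mhat st _ _ [L [_ fr]] C0 coC.
(* In dimension 0 the space is a single point. *)
have [d0|d_gt0] := posnP d.
  apply: aeW => w; exists 1; split=> // dT T Q K _ _ _ _.
  apply: aeW => q x _; apply: (sub_finite_set _ (finite_set1 x)) => y _ /=.
  by apply/rowP => -[i id]; exfalso; rewrite d0 in id.
have [[mvoid void1]|dense] := void_or_dense R d dO Omega P hat L d_gt0 fhat mhat st fr.
  have nvoid : P.-negligible (~` [set w | hat w = set0]).
    exists (~` [set w | hat w = set0]); split=> //; first exact: measurableC.
    by have := probability_setC P mvoid; rewrite void1 subee.
  apply: negligibleS nvoid => w; apply: contra_not => /= w0.
  exists 1; split=> // dT T Q K _ _ _ _.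
  by apply: aeW => q x; rewrite w0.
pose M := (d.+1 + d.+1)%N; pose B : R := ((M + M).+1 ^ d)%:R.
have B0 : 0 < B by rewrite ltr0n expn_gt0.
have W0 : 0 < walk_weight R d M by rewrite ltr0n expn_gt0 muln_gt0 expn_gt0.
set W := walk_weight R d M in W0.
(* A union bound over [B] neighbours and the walk count [W] then give ratio [W * (B * e) = 1/2]. The
   scale [s] is chosen first, then [N]. *)
pose e := (2 * W * B)^-1.
have e0 : 0 < e by rewrite invr_gt0 !mulr_gt0.
have [s [s0 Ls void]] := dense (e / 2) (divr_gt0 e0 (ltr0n _ 2)).
have [N irr] := prob_irregular_small R d dO Omega P hat s e fhat mhat s0 e0 void.
have small : W * (B * e) <= 2^-1.
  rewrite le_eqVlt; apply/orP; left; apply/eqP; rewrite /e; field.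
  by rewrite !lt0r_neq0.
have := regular_ae R d M N dO Omega P hat L s (B * e) fhat mhat fr s0 Ls
  (ltW (mulr_gt0 B0 e0)) small
  (fun u => prob_irregular_near R d M N dO Omega P hat s e u mhat st s0 irr).
move: coC; apply: filterS2 => w coC reg.
(* This bound on the opening probability makes the ratio for open walks at most 1/2; the successor
   of [N * N] avoids dividing by zero. *)
pose a := (2 * W * (B * (N * N).+1%:R))^-1.
have a0 : 0 < a by rewrite invr_gt0 !mulr_gt0.
exists (a / C); split; first exact: divr_gt0.
move=> dT T Q K mK Ksym indQ QK.
apply: (finite_clusters_ae R d N s a) => //; first exact: ltW.
  rewrite -/M -/W natrM -/B.
  have -> : W * (B * (N * N)%:R * a) = 2^-1 * ((N * N)%:R / (N * N).+1%:R).
    by rewrite /a; field; rewrite !lt0r_neq0 // ltr0n.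
  by rewrite ler_piMr ?invr_ge0 // ler_pdivrMr ?ltr0n // mul1r ler_nat.
(* With [t0 = a / C], the inequality [1 - exp(-u) <= u] bounds the opening probability by [t0 * c],
   which is at most [a] as [c <= C]. *)
move=> x y xy; rewrite (QK x y xy) lee_fin lerBlDr -lerBlDl.
apply: le_trans (expR_ge1Dx _); rewrite lerD2l lerN2.
by rewrite mulrAC ler_pdivrMr // ler_wpM2l ?(ltW a0) // coC.
Qed.
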